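(* Let $\lambda\ge 2$ be a fixed integer, let $\varepsilon>0$ be fixed, and let $(\nu_n)_{n\ge 1}$ be a fixed real sequence with $\lim_{n\to\infty}\nu_n=0$. Let $(s_n)_{n\ge 1}$ be a strictly increasing sequence of positive integers (which may depend on $X$) satisfying $s_n\le n^{15/14+\nu_n}$ for all $n$. For a prime $p$ let $D(p,X)$ denote the discrepancy of the sequence of fractional parts $$ \{\lambda^{s_n}/p\},\quad n\le X(\log X)^{2+\varepsilon}. $$ Then there exist $\varepsilon_1>0$ and a constant $C>0$ such that, as $X\to\infty$, for $\pi(X)(1+o(1))$ primes $p\le X$ one has $$ D(p, X)\le C(\log X)^{-\varepsilon_1}. $$ (In other words, for almost all primes $p\le X$, the numbers $\lambda^{s_n}$, $n\le X(\log X)^{2+\varepsilon}$, are uniformly distributed modulo $p$.)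
   Context: $\pi(X)$ denotes the number of primes not exceeding $X$. The index $n$ ranges over positive integers. The discrepancy $D$ of a sequence of $N$ points $(x_j)_{j=1}^N$ of the unit interval $[0,1)$ is $$ D =\sup_{0\le a\le b\le 1} \left|\frac{A(a,b) } {N}- (b-a)\right|, $$ where $A(a, b)$ is the number of points of the sequence (indices $j$, counted with multiplicity) which belong to $[a, b)$. The sequence $(\nu_n)$ does not depend on $X$; the constants $\varepsilon_1$ and $C$ do not depend on $X$ or $p$. *)

(* Defs.v *)
From HB Require Import structures.
From mathcomp Require Import all_boot all_order all_algebra.
From mathcomp Require Import all_classical all_reals all_analysis.

Set Implicit Arguments.
Unset Strict Implicit.
Unset Printing Implicit Defensive.

Import Order.TTheory GRing.Theory Num.Theory.
Import numFieldNormedType.Exports.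

Local Open Scope classical_set_scope.
Local Open Scope ring_scope.

Definition fracpart (R : realType) (x : R) : R := x - (Num.floor x)%:~R.

(* [count] is over the list, so repeated points count with multiplicity. *)
Definition discrepancy (R : realType) (xs : seq R) : R :=
  sup [set d : R | exists a b : R, [/\ 0 <= a, a <= b, b <= 1 &
         d = `| (count (fun x => a <= x < b) xs)%:R / (size xs)%:R - (b - a) |]].

(* [Num.truncn X] is the integer part of X for X >= 0, and 0 for X < 0. *)
Definition primes_upto (R : realType) (X : R) : seq nat :=
  [seq p <- iota 1 (Num.truncn X) | prime p].

Definition primepi (R : realType) (X : R) : nat := size (primes_upto X).

(* The number of points, the integer part of X (log X)^(2 + eps); the points
   are indexed from n = 1. *)
Definition num_points (R : realType) (eps X : R) : nat :=
  Num.truncn (X * ln X `^ (2 + eps)).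

Definition power_residues (R : realType) (lambda : nat) (s : nat -> nat)
    (N p : nat) : seq R :=
  [seq fracpart ((lambda ^ s n)%N%:R / p%:R) | n <- iota 1 N].

(* Main.v *)
Require Import Defs.
From HB Require Import structures.
From mathcomp Require Import all_boot all_order all_algebra.
From mathcomp Require Import all_classical all_reals all_analysis.
From mathcomp Require Import complex ring lra zify.

(** The exponential sums attached to the points are small for almost all primes,
    on average and uniformly in the frequency; Markov's inequality and the
    Fejer kernel then give the discrepancy bound.

    Let l = log X, let N be the number of points and S the largest s_n. For a
    prime p not dividing lambda let t be the order of lambda modulo p, and for a
    prime to p let sigma(a) be the sum over n <= N of e(a lambda^(s_n) / p).
    Expanding in characters of Z / t,

      t sigma(a) = sum over b < t of G(b) A(b / t),

    where G(b) is a Gauss sum along the orbit of lambda and A(beta) is the sum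
    of the e(beta s_n), which does not depend on p and a. Write each b / t in
    lowest terms with denominator d, a divisor of t and hence of p - 1
    [orbit_sum_bound].

    For d >= sqrt S the bound |G(b)|^2 <= p is enough [sqr_gauss_sum_le]. Summed
    over p it leaves X^2 d^(-2) times the mean square of A at the reduced
    fractions with denominator d, and the large sieve [large_sieve], applied in
    dyadic ranges of d, gives O(X^2 N l) in total.

    For d < sqrt S a power of X must be gained over |G(b)|^2 <= p. Summing first
    over a progression of L = X^(1/3) exponents and using Hoelder's inequality,

      |G(b)|^4 <= t^3 p E / L^4,

    where E is the additive energy of 1, lambda, ..., lambda^(L-1) modulo p
    [gauss_sum_energy]. Two sums of two powers of lambda agree as integers only
    trivially, and otherwise their difference has O(L) prime divisors. So E is
    at most L^2 l^2 for all but O(X / l^2) primes [sum_energy_le]. All but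
    O(X / l^2) primes also satisfy t > sqrt X / l [small_order_count] and have
    at most l^3 divisors of p - 1 [sum_divisors_le]. For the remaining primes
    |G(b)|^2 / t^2 is at most X^(-1/12) up to powers of l, and the small
    denominators contribute X^(11/12 + o(1)) S N = O(X^2 N), because
    S <= X^(15/14 + o(1)) and 11/12 + 15/14 < 2 [sum_orbit_sqr_le].

    Hence the sum over these primes of the maximum over a of |sigma(a)|^2 is
    O(X^2 N l). As N is about X l^(2 + eps), all but O(X / l^(1 + eps/2)) of them
    satisfy |sigma(a)| <= l^(- eps/4) N for every a. By Chebyshev's bound
    [primepi_ge] the exceptions made so far are o(pi(X)) primes in number
    [count_bad_primes]. Fejer's kernel of degree about l^(3 eps/16) turns the
    bound for sigma into a discrepancy O(l^(- eps/16)) [discrepancy_le]. *)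

Set Implicit Arguments.
Unset Strict Implicit.
Unset Printing Implicit Defensive.

Import Order.TTheory GRing.Theory Num.Theory.
Import numFieldNormedType.Exports.

Local Open Scope classical_set_scope.
Local Open Scope ring_scope.
Import Normc.

(** * Additive characters *)

Definition expi (R : realType) (x : R) : R[i] :=
  Complex (cos (2 * pi * x)) (sin (2 * pi * x)).

Lemma normc_ge0 (R : realType) (z : R[i]) : 0 <= normc z.
Proof. by case: z => a b; rewrite /normc sqrtr_ge0. Qed.

Lemma sqr_normcE (R : realType) (a b : R) :
  normc (Complex a b) ^+ 2 = a ^+ 2 + b ^+ 2.
Proof. by rewrite /normc sqr_sqrtr // addr_ge0 ?sqr_ge0. Qed.

Lemma normc_sum (R : realType) (I : Type) (r : seq I) (P : pred I)
    (F : I -> R[i]) :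
  normc (\sum_(i <- r | P i) F i) <= \sum_(i <- r | P i) normc (F i).
Proof.
elim/big_rec2: _ => [|i x y _ h]; first by rewrite normc0.
exact: le_trans (le_normcD _ _) (lerD _ _).
Qed.

Lemma normc_expi (R : realType) (x : R) : normc (expi x) = 1.
Proof. by rewrite /expi /normc cos2Dsin2 sqrtr1. Qed.

Lemma expiD (R : realType) (x y : R) : expi (x + y) = expi x * expi y.
Proof.
rewrite /expi mulrDr cosD sinD; apply/eqP; rewrite eq_complex /= eqxx /=.
by rewrite addrC eqxx.
Qed.

Lemma expi0 (R : realType) : expi (0 : R) = 1.
Proof. by rewrite /expi mulr0 cos0 sin0. Qed.

Lemma conjc_expi (R : realType) (x : R) : conjc (expi x) = expi (- x).
Proof. by rewrite /expi /= mulrN cosN sinN. Qed.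

Lemma expi1 (R : realType) : expi (1 : R) = 1.
Proof. by rewrite /expi mulr1 mulr_natl cos2pi sin2pi. Qed.

Lemma expi_nat (R : realType) (n : nat) : expi (n%:R : R) = 1.
Proof.
by elim: n => [|n IH]; rewrite ?expi0 // -[n.+1]addn1 natrD expiD IH expi1 mul1r.
Qed.

Lemma expi_int (R : realType) (m : int) : expi (m%:~R : R) = 1.
Proof.
case: m => n; first exact: expi_nat.
by rewrite NegzE mulrNz -conjc_expi (expi_nat R n.+1) conjc1.
Qed.

Lemma expiDint (R : realType) (x : R) (m : int) : expi (x + m%:~R) = expi x.
Proof. by rewrite expiD expi_int mulr1. Qed.

Lemma expi_natM (R : realType) (x : R) (n : nat) : expi (n%:R * x) = expi x ^+ n.
Proof.
elim: n => [|n IH]; first by rewrite mul0r expi0 expr0.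
by rewrite -[n.+1]addn1 natrD mulrDl mul1r expiD IH exprD expr1.
Qed.

(** Doubling an angle at most doubles the chord, and an angle of at least a
    quarter turn already has chord at least 1. *)
Lemma normc_1Bexpi_ge (R : realType) (x : R) :
  `|x| <= 1 / 2 -> 2 * `|x| <= normc (1 - expi x).
Proof.
have far (y : R) : 1 / 4 <= `|y| <= 1 / 2 -> 1 <= normc (1 - expi y).
  move=> /andP[y1 y2]; rewrite -(@ler_sqr _ 1) ?nnegrE ?normc_ge0 //.
  have -> : (1 - expi y : R[i]) = Complex (1 - cos (2 * pi * y)) (- sin (2 * pi * y)).
    by rewrite /expi; apply/eqP; rewrite eq_complex /= eqxx add0r eqxx.
  rewrite sqr_normcE sqrrN expr1n.
  have cle : cos (2 * pi * y) <= 0.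
    rewrite -cos_norm -[`|_|](subrK (pi / 2)) addrC addrC cosDpihalf oppr_le0.
    apply: sin_ge0_pi; have p0 := pi_gt0 R.
    rewrite normrM (ger0_norm (_ : 0 <= 2 * pi)); last by nra.
    by apply/andP; split; nra.
  have := cos2Dsin2 (2 * pi * y); nra.
have [->|x0] := eqVneq x 0; first by rewrite normr0 mulr0 normc_ge0.
have nx : 0 < `|x| by rewrite normr_gt0.
have [k] : exists k : nat, 1 / 4 <= 2 ^+ k * `|x|.
  exists (Num.truncn (1 / `|x|)).+1.
  have h := truncnS_gt (1 / `|x|).
  rewrite ltr_pdivrMr // in h.
  have : ((Num.truncn (1 / `|x|)).+1%:R : R) <= 2 ^+ (Num.truncn (1 / `|x|)).+1.
    by rewrite -natrX ler_nat ltnW // ltn_expl.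
  nra.
elim: k x {x0} nx => [|k IH] x nx h1 h2.
  rewrite expr0 in h1.
  by apply: le_trans (far x _); [lra|apply/andP; split; lra].
have [h3|h3] := leP (1 / 4) `|x|.
  by apply: le_trans (far x _); [lra|apply/andP; split].
have n2 : `|2 * x| = 2 * `|x| by rewrite normrM ger0_norm.
have := IH (2 * x); rewrite n2.
have -> : expi (2 * x) = expi x ^+ 2 by rewrite -expi_natM.
rewrite -[X in X - _](expr1n _ 2) subr_sqr normcM mulrCA => h.
have : 2 * (2 * `|x|) <= normc (1 - expi x) * normc (1 + expi x).
  apply: h; [lra| |lra].
  by move: h1; rewrite exprS -mulrA.
have : normc (1 + expi x) <= 2.
  by apply: le_trans (le_normcD _ _) _; rewrite normc_expi normc1.
have := normc_ge0 (1 - expi x); nra.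
Qed.

Definition dirichlet (R : realType) (K : nat) (x : R) : R[i] :=
  \sum_(k < K) expi (k%:R * x).

Lemma dirichletE (R : realType) (K : nat) (x : R) :
  dirichlet K x * (1 - expi x) = 1 - expi (K%:R * x).
Proof.
rewrite /dirichlet expi_natM -[in RHS](expr1n _ K) subrXX mulrC.
congr (_ * _); apply: eq_bigr => k _.
by rewrite expr1n mul1r expi_natM.
Qed.

Lemma dirichletDint (R : realType) (K : nat) (x : R) (m : int) :
  dirichlet K (x + m%:~R) = dirichlet K x.
Proof. by apply: eq_bigr => k _; rewrite !expi_natM expiDint. Qed.

Lemma normc_dirichlet_le (R : realType) (K : nat) (x : R) :
  normc (dirichlet K x) <= K%:R.
Proof.
apply: le_trans (normc_sum _ _ _) _.
by under eq_bigr do rewrite normc_expi; rewrite sumr_const card_ord.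
Qed.

Lemma nearest_int (R : realType) (x : R) : exists m : int, `|x - m%:~R| <= 1 / 2.
Proof.
exists (Num.floor (x + 1 / 2)).
have /andP[h1 h2] := floor_itv (x + 1 / 2).
rewrite ler_norml; move: h2; rewrite intrD => h2; apply/andP; split; lra.
Qed.

(** The geometric sum telescopes against 1 - expi x, whose modulus is bounded
    below by the chord estimate. *)
Lemma normc_dirichlet_mul (R : realType) (K : nat) (x : R) :
  `|x| <= 1 / 2 -> normc (dirichlet K x) * `|x| <= 1.
Proof.
move=> /normc_1Bexpi_ge h.
have : normc (dirichlet K x) * normc (1 - expi x) <= 2.
  rewrite -normcM dirichletE; apply: le_trans (le_normcD _ _) _.
  by rewrite normcN normc1 normc_expi.
by have := normc_ge0 (dirichlet K x); nra.
Qed.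

(** Orthogonality of the characters of Z / m: off the multiples of m the
    telescoped sum vanishes while the factor 1 - expi does not. *)
Lemma sumr_dirichlet (R : realType) (m : nat) (k : int) : (0 < m)%N ->
  dirichlet m (k%:~R / m%:R : R) = if (m %| k)%Z then m%:R else 0.
Proof.
move=> m0; have mR : (m%:R : R) != 0 by rewrite pnatr_eq0 -lt0n.
case: ifP => [/dvdzP[q ->]|ndv].
  rewrite rmorphM /= mulfK //.
  rewrite /dirichlet; under eq_bigr do rewrite expi_natM expi_int expr1n.
  by rewrite sumr_const card_ord.
have := dirichletE m (k%:~R / m%:R : R).
have -> : m%:R * (k%:~R / m%:R) = k%:~R :> R by rewrite mulrC divfK.
rewrite expi_int subrr => /eqP.
rewrite mulf_eq0 => /orP[/eqP->//|/eqP h].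
have [q hq] := nearest_int (k%:~R / m%:R : R).
have := normc_1Bexpi_ge hq; rewrite -mulrNz expiDint h normc0 => h0.
have /eqP : `|k%:~R / m%:R - q%:~R| = 0 :> R.
  by apply/eqP; rewrite eq_le normr_ge0 andbT -mulrNz; lra.
rewrite normr_eq0 subr_eq0 => /eqP h1.
move: ndv; suff -> : k = q * m by rewrite dvdz_mull.
apply/eqP; rewrite -(eqr_int R) rmorphM /= -h1.
by rewrite -[m%:~R]/(m%:R) divfK.
Qed.

(** * Mean squares *)

(** Lagrange's identity: the defect is half the sum of the squares of
    a i * b j - a j * b i. *)
Lemma cauchy_schwarz (R : realDomainType) (I : Type) (r : seq I) (P : pred I)
    (a b : I -> R) :
  (\sum_(i <- r | P i) a i * b i) ^+ 2 <=
  (\sum_(i <- r | P i) a i ^+ 2) * (\sum_(i <- r | P i) b i ^+ 2).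
Proof.
set c := \sum_(i <- r | P i) _; set A := \sum_(i <- r | P i) _ ^+ 2.
set B := \sum_(i <- r | P i) _ ^+ 2.
have : 0 <= \sum_(i <- r | P i) \sum_(j <- r | P j) (a i * b j - a j * b i) ^+ 2.
  by apply: sumr_ge0 => i _; apply: sumr_ge0 => j _; apply: sqr_ge0.
have -> : \sum_(i <- r | P i) \sum_(j <- r | P j) (a i * b j - a j * b i) ^+ 2
    = 2 * (A * B - c ^+ 2).
  transitivity (\sum_(i <- r | P i) (a i ^+ 2 * B - 2 * (a i * b i) * c + b i ^+ 2 * A)).
    apply: eq_bigr => i _; rewrite /A /B /c !mulr_sumr -sumrB -big_split /=.
    by apply: eq_bigr => j _; ring.
  rewrite big_split sumrB /= -!mulr_suml -!mulr_sumr -/A -/B -/c; ring.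
by nra.
Qed.

Lemma cauchy_schwarz1 (R : realDomainType) (I : Type) (r : seq I) (P : pred I)
    (a : I -> R) :
  (\sum_(i <- r | P i) a i) ^+ 2 <= (count P r)%:R * \sum_(i <- r | P i) a i ^+ 2.
Proof.
have := cauchy_schwarz r P (fun=> 1) a.
under eq_bigr do rewrite mul1r.
rewrite expr1n big_const_seq iter_addr_0.
by [].
Qed.

Lemma cauchy_schwarz_card (R : realDomainType) (I : finType) (P : pred I)
    (a : I -> R) :
  (\sum_(i | P i) a i) ^+ 2 <= #|P|%:R * \sum_(i | P i) a i ^+ 2.
Proof.
have := cauchy_schwarz (index_enum I) P (fun=> 1) a.
under eq_bigr do rewrite mul1r.
by rewrite expr1n sumr_const.
Qed.

Lemma sqr_normc_conj (R : realType) (z : R[i]) :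
  ((normc z ^+ 2)%:C)%C = z * conjc z.
Proof. by rewrite rmorphXn /= -sqr_normc. Qed.

Lemma normc_real (R : realType) (x : R) : normc (x%:C)%C = `|x|.
Proof. by rewrite /normc /= expr0n addr0 sqrtr_sqr. Qed.

Lemma normc_conj (R : realType) (z : R[i]) : normc (conjc z) = normc z.
Proof. by case: z => a b; rewrite /normc /= sqrrN. Qed.

Lemma conjcM (R : realType) (a b : R[i]) : conjc (a * b) = conjc a * conjc b.
Proof. exact: rmorphM. Qed.

Lemma normc_sqr_sum (R : realType) (I : Type) (r : seq I) (P : pred I)
    (F : I -> R[i]) :
  ((normc (\sum_(i <- r | P i) F i) ^+ 2)%:C)%C =
  \sum_(i <- r | P i) \sum_(j <- r | P j) F i * conjc (F j).
Proof.
rewrite sqr_normc_conj rmorph_sum mulr_suml; apply: eq_bigr => i _.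
by rewrite mulr_sumr.
Qed.

(** The form in which sums over injective images are compared with full sums. *)
Lemma ler_sum_uniq (R : realDomainType) (ss : seq nat) (K : nat) (g : nat -> R) :
  uniq ss -> all (fun k => k < K)%N ss -> (forall k, 0 <= g k) ->
  \sum_(k <- ss) g k <= \sum_(k < K) g k.
Proof.
move=> us /allP sK g0.
have pe : perm_eq ss [seq k <- iota 0 K | k \in ss].
  apply: uniq_perm => //; first by rewrite filter_uniq // iota_uniq.
  move=> k; rewrite mem_filter mem_iota add0n leq0n /=.
  by case: (boolP (k \in ss)) => // /sK ->.
rewrite (perm_big _ pe) big_filter -(big_mkord xpredT) /index_iota subn0 /=.
by rewrite [leRHS](bigID (fun k => k \in ss)) /= lerDl sumr_ge0.
Qed.

Lemma sum_inv_sqr_le2 (R : realFieldType) (B : nat) :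
  \sum_(k < B) (k%:R ^- 2 : R) <= 2.
Proof.
suff h : \sum_(k < B.+1) (k%:R ^- 2 : R) <= 2 - B%:R^-1.
  apply: le_trans (le_trans h _); last by rewrite gerBl invr_ge0.
  by rewrite big_ord_recr /= lerDl invr_ge0 exprn_ge0.
elim: B => [|B IH].
  by rewrite big_ord_recr big_ord0 /= mulr0n expr0n /= !invr0 ?mulr0n subr0 addr0.
case: B IH => [_|B IH].
  rewrite !big_ord_recr big_ord0 /= mulr0n mulr1n expr0n expr1n /= invr0 invr1; lra.
rewrite big_ord_recr /=; apply: le_trans (lerD IH (lexx _)) _.
set b : R := B.+1%:R; have b0 : 0 < b by rewrite ltr0n.
have -> : B.+2%:R = b + 1 :> R by rewrite -natr1.
rewrite -subr_ge0.
have -> : 2 - (b + 1)^-1 - (2 - b^-1 + (b + 1) ^- 2) = b^-1 * (b + 1) ^- 2.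
  by field; apply/andP; split; lra.
by rewrite mulr_ge0 // invr_ge0 ?exprn_ge0 //; lra.
Qed.

Lemma sum_inv_sqr_inj (R : realFieldType) (I : finType) (P : pred I) (f : I -> nat) :
  {in P &, injective f} -> \sum_(i | P i) ((f i)%:R ^- 2 : R) <= 2.
Proof.
move=> finj; pose ss := [seq f i | i <- enum P].
have -> : \sum_(i | P i) ((f i)%:R ^- 2 : R) = \sum_(k <- ss) k%:R ^- 2.
  by rewrite big_map big_enum.
apply: le_trans (sum_inv_sqr_le2 R (\max_(k <- ss) k).+1).
apply: ler_sum_uniq.
- by rewrite map_inj_in_uniq ?enum_uniq // => x y; rewrite !mem_enum; apply: finj.
- by apply/allP => k ks; rewrite ltnS; apply: leq_bigmax_seq.
- by move=> k; rewrite invr_ge0 exprn_ge0.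
Qed.

(** Orthogonality of the additive characters modulo p turns the mean square
    over all residues z into a count of congruences. *)
Lemma mean_square_le (R : realType) (I : finType) (w : I -> R[i]) (f : I -> nat)
    (p : nat) :
  (0 < p)%N -> (forall i, normc (w i) <= 1) ->
  \sum_(z < p) normc (\sum_i w i * expi ((z * f i)%:R / p%:R : R)) ^+ 2 <=
  p%:R * #|[pred ij : I * I | f ij.1 == f ij.2 %[mod p]]|%:R.
Proof.
move=> p0 w1; set L := \sum_(z < p) _.
have L0 : 0 <= L by apply: sumr_ge0 => z _; apply: sqr_ge0.
rewrite -(ger0_norm L0) -normc_real /L rmorph_sum /=.
under eq_bigr do rewrite normc_sqr_sum pair_bigA.
rewrite exchange_big /=.
apply: le_trans (normc_sum _ _ _) _.
rewrite -sum1_card natr_sum mulr_sumr [leRHS]big_mkcond /=.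
apply: ler_sum => -[i j] _ /=; rewrite inE /=.
have -> : \sum_(z < p) w i * expi ((z * f i)%:R / p%:R : R) *
     conjc (w j * expi ((z * f j)%:R / p%:R : R)) =
   w i * conjc (w j) * dirichlet p (((f i)%:Z - (f j)%:Z)%:~R / p%:R : R).
  rewrite /dirichlet mulr_sumr; apply: eq_bigr => z _.
  rewrite conjcM conjc_expi mulrACA -expiD; congr (_ * expi _).
  rewrite rmorphB /= !natrM -!pmulrn; field.
  by rewrite pnatr_eq0 -lt0n.
rewrite sumr_dirichlet // -eqz_mod_dvd !normcM normc_conj.
have -> : ((f i)%:Z == (f j)%:Z %[mod p])%Z = (f i == f j %[mod p])%N.
  by rewrite !modz_nat eqz_nat.
case: ifP => _; last by rewrite normc0 mulr0.
have := w1 i; have := w1 j; have := normc_ge0 (w i); have := normc_ge0 (w j).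
have -> : normc (p%:R : R[i]) = p%:R.
  by rewrite -(rmorph_nat (real_complex R)) normc_real ger0_norm.
have : 0 <= p%:R :> R by [].
move=> pp a1 a2 a3 a4; rewrite -[leRHS]mul1r mulr1 ler_wpM2r //.
by rewrite -[1]mulr1 ler_pM.
Qed.

(** * The large sieve *)

Lemma conjc_dirichlet (R : realType) (K : nat) (x : R) :
  conjc (dirichlet K x) = dirichlet K (- x).
Proof.
rewrite /dirichlet (raddf_sum (@conjc R)); apply: eq_bigr => k _.
by rewrite mulrN -conjc_expi.
Qed.

(** The dual form of the large sieve. Each k in ss is the difference of k + j
    and j for S values of j, so that S times the left-hand side is a sum over
    pairs (k + j, j) inside the square of side 2 S. After Cauchy-Schwarz the
    pairs may be taken to fill the whole square, where the sums over i and j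
    are geometric. Filling the square amounts to a Fejer weight on the range
    of k, so that the kernel decays quadratically and no logarithm is lost. *)
Lemma large_sieve_dual (R : realType) (I : finType) (P : pred I) (al : I -> R)
    (ss : seq nat) (S : nat) (M : R) :
  uniq ss -> all (fun k => k < S)%N ss -> (0 < S)%N -> 0 <= M ->
  (forall r, P r ->
     \sum_(s | P s) normc (dirichlet (2 * S) (al r - al s)) ^+ 2 <= M) ->
  \sum_(r | P r) normc (\sum_(k <- ss) expi (k%:R * al r)) ^+ 2 <=
  M * (size ss)%:R / S%:R.
Proof.
move=> us ltS S0 M0 hM; set K := (2 * S)%N.
set A := fun r => \sum_(k <- ss) expi (k%:R * al r).
set T := \sum_(r | P r) _; rewrite -/A in T *.
have T0 : 0 <= T by apply: sumr_ge0 => r _; apply: sqr_ge0.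
pose V i j := \sum_(r | P r) conjc (A r) * (expi (i%:R * al r) * expi (- (j%:R * al r))).
have V0 i j : 0 <= normc (V i j) ^+ 2 by apply: sqr_ge0.
have ST : S%:R * T <= \sum_(j < S) \sum_(k <- ss) normc (V (k + j)%N j).
  have : ((S%:R * T)%:C)%C = \sum_(j < S) \sum_(k <- ss) V (k + j)%N j.
    rewrite rmorphM rmorph_sum /= rmorph_nat mulr_natl.
    rewrite -[S in LHS]card_ord -sumr_const; apply: eq_bigr => j _.
    rewrite /V exchange_big /=; apply: eq_bigr => r _.
    rewrite sqr_normc_conj mulrC -mulr_sumr; congr (_ * _).
    apply: eq_bigr => k _; rewrite -expiD; congr expi.
    by rewrite natrD; ring.
  move=> /(congr1 (@normc R)); rewrite normc_real ger0_norm ?mulr_ge0 // => ->.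
  apply: le_trans (normc_sum _ _ _) _; apply: ler_sum => j _.
  exact: normc_sum.
set W := \sum_(j < K) \sum_(i < K) normc (V i j) ^+ 2.
have hW : (S%:R * T) ^+ 2 <= (S%:R * (size ss)%:R) * W.
  have ST0 : 0 <= S%:R * T by rewrite mulr_ge0.
  apply: le_trans (_ : (\sum_(j < S) \sum_(k <- ss) normc (V (k + j)%N j)) ^+ 2 <= _).
    by rewrite ler_sqr ?nnegrE // (le_trans ST0).
  apply: le_trans (cauchy_schwarz_card _ _) _.
  rewrite card_ord -mulrA ler_wpM2l //.
  apply: le_trans (_ : \sum_(j < S) (size ss)%:R * \sum_(i < K) normc (V i j) ^+ 2 <= _).
    apply: ler_sum => j _.
    apply: le_trans (cauchy_schwarz1 _ _ _) _; rewrite count_predT ler_wpM2l //.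
    have -> : \sum_(k <- ss) normc (V (k + j)%N j) ^+ 2 =
              \sum_(i <- [seq (k + j)%N | k <- ss]) normc (V i j) ^+ 2.
      by rewrite big_map.
    apply: ler_sum_uniq => //.
      by rewrite map_inj_uniq // => x y /addIn.
    apply/allP => _ /mapP[k /(allP ltS) kS ->].
    by have := ltn_ord j; rewrite /K; lia.
  rewrite -mulr_sumr ler_wpM2l //.
  rewrite /W.
  rewrite -(big_mkord xpredT (fun j => \sum_(i < K) normc (V i j) ^+ 2)).
  rewrite -(big_mkord xpredT (fun j => \sum_(i < K) normc (V i j) ^+ 2)).
  rewrite [leRHS](@big_cat_nat _ _ _ S) //=; last by rewrite /K; lia.
  by rewrite lerDl sumr_ge0 // => j _; apply: sumr_ge0.
have WM : W <= M * T.
  have W0 : 0 <= W by apply: sumr_ge0 => j _; apply: sumr_ge0.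
  have : (W%:C)%C = \sum_(r | P r) \sum_(s | P s) conjc (A r) * A s *
      (dirichlet K (al r - al s) * conjc (dirichlet K (al r - al s))).
    rewrite /W rmorph_sum /=.
    under eq_bigr do rewrite rmorph_sum /=.
    under eq_bigr do under eq_bigr do rewrite /V normc_sqr_sum.
    under eq_bigr do rewrite exchange_big /=.
    rewrite exchange_big /=; apply: eq_bigr => r _.
    under eq_bigr do rewrite exchange_big /=.
    rewrite exchange_big /=; apply: eq_bigr => s _.
    rewrite exchange_big /=.
    rewrite {1}/dirichlet mulr_suml mulr_sumr; apply: eq_bigr => i _.
    rewrite conjc_dirichlet /dirichlet [X in _ = _ * X]mulr_sumr [RHS]mulr_sumr; apply: eq_bigr => j _.
    rewrite !conjcM !conjc_expi opprK (conjcK (A s)) [LHS]mulrACA; congr (_ * _).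
    rewrite -!expiD; congr expi; ring.
  move=> /(congr1 (@normc R)); rewrite normc_real ger0_norm // => ->.
  apply: le_trans (normc_sum _ _ _) _.
  apply: le_trans (_ : \sum_(r | P r) \sum_(s | P s)
     (normc (A r) ^+ 2 / 2 + normc (A s) ^+ 2 / 2) * normc (dirichlet K (al r - al s)) ^+ 2 <= _).
    apply: ler_sum => r _; apply: le_trans (normc_sum _ _ _) _.
    apply: ler_sum => s _; rewrite !normcM !normc_conj -expr2 ler_wpM2r ?sqr_ge0 //.
    by have := sqr_ge0 (normc (A r) - normc (A s)); nra.
  have sym r s : normc (dirichlet K (al r - al s)) = normc (dirichlet K (al s - al r)).
    by rewrite -[RHS]normc_conj conjc_dirichlet opprB.
  pose h r := \sum_(s | P s) normc (A r) ^+ 2 / 2 * normc (dirichlet K (al r - al s)) ^+ 2.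
  have hh : \sum_(r | P r) h r <= M * T / 2.
    rewrite /T mulr_sumr mulr_suml; apply: ler_sum => r Pr.
    rewrite /h -mulr_sumr -/(A r) mulrAC ler_wpM2r ?invr_ge0 //.
    by rewrite mulrC ler_wpM2r ?sqr_ge0 ?hM.
  rewrite (_ : M * T = M * T / 2 + M * T / 2); last by field.
  under eq_bigr do under eq_bigr do rewrite mulrDl.
  under eq_bigr do rewrite big_split /=.
  rewrite big_split /=; apply: (lerD hh).
  rewrite exchange_big /=; apply: le_trans hh; rewrite le_eqVlt; apply/orP; left.
  by apply/eqP; apply: eq_bigr => r _; apply: eq_bigr => s _; rewrite sym.
have [->|Tn0] := eqVneq T 0.
  by rewrite !mulr_ge0 ?invr_ge0.
have Tp : 0 < T by rewrite lt_neqAle eq_sym Tn0.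
have Sp : 0 < S%:R :> R by rewrite ltr0n.
rewrite ler_pdivlMr //.
rewrite -(ler_pM2r (_ : 0 < S%:R * T)); last by rewrite mulr_gt0.
have : (S%:R * T) ^+ 2 <= S%:R * (size ss)%:R * (M * T).
  by apply: le_trans hW _; rewrite ler_wpM2l // mulr_ge0.
by rewrite expr2; lra.
Qed.

(** Let k s be the number of times dl fits into the distance from al s to al r
    modulo 1. On each side of al r the spacing makes k injective, so the sum is
    governed by twice the convergent series of k ^- 2. *)
Lemma spaced_dirichlet_sum (R : realType) (I : finType) (P : pred I) (al : I -> R)
    (dl : R) (K : nat) (r : I) :
  0 < dl ->
  (forall s s', P s -> P s' -> s != s' ->
     forall m : int, dl <= `|al s - al s' - m%:~R|) ->
  P r ->
  \sum_(s | P s) normc (dirichlet K (al r - al s)) ^+ 2 <= K%:R ^+ 2 + 4 / dl ^+ 2.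
Proof.
move=> dl0 sp Pr.
have [m hm] := choice (fun s => nearest_int (al r - al s)).
pose u s := al r - al s - (m s)%:~R.
pose k s := Num.truncn (`|u s| / dl).
have D0 s : 0 <= normc (dirichlet K (al r - al s)) ^+ 2 by apply: sqr_ge0.
have far s : P s -> s != r ->
    normc (dirichlet K (al r - al s)) ^+ 2 <= dl ^- 2 * (k s)%:R ^- 2.
  move=> Ps sr.
  have ud : dl <= `|u s| by apply: sp => //; rewrite eq_sym.
  have k1 : (0 < k s)%N by rewrite truncn_gt0 ler_pdivlMr // mul1r.
  have kR : 0 < (k s)%:R :> R by rewrite ltr0n.
  have ku : (k s)%:R * dl <= `|u s|.
    by rewrite -ler_pdivlMr // truncn_le // divr_ge0 // ltW.
  have := normc_dirichlet_mul K (hm s : `|u s| <= 1 / 2).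
  rewrite /u -mulrNz dirichletDint mulrNz -/(u s) => h.
  rewrite -exprVn -exprVn -exprMn ler_sqr ?nnegrE ?normc_ge0 //; last first.
    by rewrite mulr_ge0 // invr_ge0 ltW.
  rewrite -invfM -[leRHS]mul1r ler_pdivlMr ?mulr_gt0 //.
  apply: le_trans h; rewrite ler_wpM2l ?normc_ge0 //.
  by rewrite mulrC.
have kinj (s s' : I) : P s -> P s' -> k s = k s' ->
    (0 <= u s) = (0 <= u s') -> s = s'.
  move=> Ps Ps' kk sg; apply/eqP/negPn/negP => ss'.
  have := sp _ _ Ps Ps' ss' (m s' - m s); apply/negP; rewrite -ltNge.
  have -> : al s - al s' - (m s' - m s)%:~R = u s' - u s.
    by rewrite /u intrB; ring.
  have b (v : I) : (k v)%:R * dl <= `|u v| < ((k v)%:R + 1) * dl.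
    rewrite -ler_pdivlMr // -ltr_pdivrMr // natr1 truncn_itv //.
    by rewrite divr_ge0 // ltW.
  have := b s; have := b s'; rewrite kk => /andP[b1 b2] /andP[b3 b4].
  have : `|u s' - u s| = `| `|u s'| - `|u s| |.
    move: sg; case: (leP 0 (u s)) => h1 /esym h2.
      by rewrite (ger0_norm h1) (ger0_norm h2).
    move/negbT: h2; rewrite -ltNge => h2.
    by rewrite (ltr0_norm h1) (ltr0_norm h2) -normrN opprB opprK addrC.
  by move=> ->; rewrite ltr_norml; apply/andP; split; lra.
rewrite (bigD1 r) //=; apply: lerD.
  by rewrite ler_sqr ?nnegrE ?normc_ge0 ?normc_dirichlet_le.
apply: le_trans (_ : \sum_(s | P s && (s != r)) dl ^- 2 * (k s)%:R ^- 2 <= _).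
  by apply: ler_sum => s /andP[Ps sr]; apply: far.
rewrite -mulr_sumr mulrC ler_wpM2r ?invr_ge0 ?sqr_ge0 //.
rewrite (bigID (fun s => 0 <= u s)) /= (_ : 4 = 2 + 2); last by ring.
by apply: lerD; apply: sum_inv_sqr_inj => s s';
  rewrite !unfold_in => /andP[/andP[Ps _] us] /andP[/andP[Ps' _] us'] h;
  apply: kinj => //; rewrite ?(negbTE us) ?(negbTE us') ?us ?us'.
Qed.

Definition farey_sum (R : realType) (ss : seq nat) (d : nat) : R :=
  \sum_(b < d | coprime b d)
     normc (\sum_(k <- ss) expi (k%:R * (b%:R / d%:R))) ^+ 2.

Lemma farey_sum_ge0 (R : realType) (ss : seq nat) (d : nat) :
  0 <= farey_sum R ss d.
Proof. by apply: sumr_ge0 => b _; apply: sqr_ge0. Qed.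

(** The difference of two reduced fractions and an integer is an integer over
    d * d', and that integer is not 0. *)
Lemma farey_spaced (R : realType) (Q d b d' b' : nat) (m : int) :
  (b < d <= Q)%N -> (b' < d' <= Q)%N -> coprime b d -> coprime b' d' ->
  (d, b) != (d', b') ->
  (Q%:R ^+ 2)^-1 <= `|b%:R / d%:R - b'%:R / d'%:R - m%:~R| :> R.
Proof.
move=> /andP[bd dQ] /andP[bd' dQ'] cb cb' ne.
have d0 : (0 < d)%N by apply: leq_ltn_trans bd.
have d0' : (0 < d')%N by apply: leq_ltn_trans bd'.
have dR : 0 < d%:R :> R by rewrite ltr0n.
have dR' : 0 < d'%:R :> R by rewrite ltr0n.
pose z : int := (b * d')%N%:Z - (b' * d)%N%:Z - m * (d * d')%N%:Z.
have -> : b%:R / d%:R - b'%:R / d'%:R - m%:~R = z%:~R / (d%:R * d'%:R) :> R.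
  rewrite /z !intrB !PoszM !intrM -!pmulrn; field.
  by apply/andP; split; apply: lt0r_neq0.
have z0 : z != 0.
  apply: contra ne => /eqP zE.
  have m0 : m = 0.
    have h1 : (b * d' < d * d')%N by rewrite ltn_pmul2r.
    have h2 : (b' * d < d * d')%N by rewrite mulnC ltn_pmul2l.
    have h3 : (0 < d * d')%N by rewrite muln_gt0 d0.
    move: zE h1 h2 h3; rewrite /z; move: (b * d')%N (b' * d)%N (d * d')%N.
    move=> x y D /eqP; rewrite subr_eq0 => /eqP E xD yD _.
    have : `|m * D| < D by rewrite -E; lia.
    by rewrite normrM => h; case: (m =P 0) => // m0; have : 1 <= `|m|; [lia|nia].
  have E : (b * d' = b' * d)%N by move: zE; rewrite /z m0; lia.
  have dd : d = d'.
    apply/eqP; rewrite eqn_dvd; apply/andP; split.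
      by rewrite -(Gauss_dvdr (m := d) (n := b)) ?E ?dvdn_mull // coprime_sym.
    by rewrite -(Gauss_dvdr (m := d') (n := b')) -?E ?dvdn_mull // coprime_sym.
  move/eqP: E; rewrite dd eqn_pmul2r // => /eqP ->; exact: eqxx.
rewrite normrM normfV (ger0_norm (_ : 0 <= d%:R * d'%:R)) ?mulr_ge0 //.
have z1 : 1 <= `|z%:~R| :> R.
  by rewrite -intr_norm -[1]/(1%:~R) ler_int; lia.
apply: le_trans (_ : 1 / (d%:R * d'%:R) <= _); last first.
  by rewrite ler_wpM2r // invr_ge0 mulr_ge0.
have QR : 0 < Q%:R :> R by rewrite ltr0n (leq_trans d0).
rewrite div1r lef_pV2 ?posrE ?mulr_gt0 ?exprn_gt0 //.
by rewrite expr2 ler_pM ?ler_nat.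
Qed.

Lemma large_sieve (R : realType) (ss : seq nat) (S Q : nat) :
  uniq ss -> all (fun k => k < S)%N ss ->
  \sum_(d < Q.+1) farey_sum R ss d <= 8 * (S%:R + Q%:R ^+ 2) * (size ss)%:R.
Proof.
move=> us ltS.
have [->|Q0] := posnP Q.
  rewrite big_ord_recr big_ord0 /= /farey_sum big_ord0 add0r.
  by rewrite !mulr_ge0 ?addr_ge0 ?sqr_ge0.
set S' := maxn S (Q ^ 2).
have S'0 : (0 < S')%N by rewrite leq_max expn_gt0 Q0 orbT.
have S'R : 0 < S'%:R :> R by rewrite ltr0n.
have QR : 0 < Q%:R :> R by rewrite ltr0n.
pose P (x : 'I_Q.+1 * 'I_Q.+1) := (x.2 < x.1)%N && coprime x.2 x.1.
pose al (x : 'I_Q.+1 * 'I_Q.+1) : R := x.2%:R / x.1%:R.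
have -> : \sum_(d < Q.+1) farey_sum R ss d =
    \sum_(x | P x) normc (\sum_(k <- ss) expi (k%:R * al x)) ^+ 2.
  rewrite (eq_bigl (fun x => xpredT x.1 && P x)) //.
  rewrite -(pair_big_dep xpredT (fun d b => P (d, b))
     (fun d b => normc (\sum_(k <- ss) expi (k%:R * al (d, b))) ^+ 2)) /=.
  apply: eq_bigr => d _; rewrite /farey_sum /P /al /=.
  rewrite (big_ord_widen_cond Q.+1 (fun b => coprime b d)
     (fun b => normc (\sum_(k <- ss) expi (k%:R * (b%:R / d%:R))) ^+ 2)) //.
    by apply: eq_bigl => b; rewrite andbC.
  by rewrite ltnW.
(* S' is at least the length of the range and at least the inverse Q ^ 2 of the
   spacing, so that neither term of the kernel sum exceeds 4 S' ^ 2. *)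
apply: le_trans (large_sieve_dual (S := S') (M := 8 * S'%:R ^+ 2) us _ S'0 _ _) _.
- apply/allP => k /(allP ltS) kS; rewrite leq_max kS //.
- by rewrite mulr_ge0 // sqr_ge0.
- move=> r Pr; apply: le_trans (spaced_dirichlet_sum (dl := (Q%:R ^+ 2)^-1) _ _ _ Pr) _.
  + by rewrite invr_gt0 exprn_gt0.
  + move=> [d b] [d' b'] /andP[/= h1 h2] /andP[/= h3 h4] ne m.
    have hd : (b < d <= Q)%N by rewrite h1 -ltnS ltn_ord.
    have hd' : (b' < d' <= Q)%N by rewrite h3 -ltnS ltn_ord.
    have ne' : (nat_of_ord d, nat_of_ord b) != (nat_of_ord d', nat_of_ord b').
      by apply: contra ne => /eqP[/val_inj -> /val_inj ->].
    exact: (farey_spaced R m hd hd' h2 h4 ne').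
  + rewrite exprVn invrK natrM.
    have : Q%:R ^+ 2 <= S'%:R :> R by rewrite -natrX ler_nat leq_maxr.
    have : 0 <= Q%:R ^+ 2 :> R by rewrite sqr_ge0.
    set q := Q%:R ^+ 2; nra.
rewrite mulrAC ler_wpM2r // expr2 mulrA mulfK ?lt0r_neq0 // ler_wpM2l //.
rewrite -natrX -natrD ler_nat geq_max leq_addr leq_addl //.
Qed.

(** * Gauss sums along the orbit of lambda *)

Lemma expi_modn (R : realType) (p x y : nat) : (0 < p)%N -> x = y %[mod p] ->
  expi (x%:R / p%:R : R) = expi (y%:R / p%:R).
Proof.
move=> p0 xy.
have red z : expi (z%:R / p%:R : R) = expi ((z %% p)%:R / p%:R).
  rewrite {1}(divn_eq z p) natrD natrM mulrDl mulfK ?pnatr_eq0 -?lt0n //.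
  by rewrite expiD expi_nat mul1r.
by rewrite red xy -red.
Qed.

Lemma sum_shift_periodic (V : zmodType) (t : nat) (F : nat -> V) (l : nat) :
  (forall x, F (x + t)%N = F x) -> \sum_(y < t) F (y + l)%N = \sum_(y < t) F y.
Proof.
move=> per; elim: l => [|l <-]; first by apply: eq_bigr => y _; rewrite addn0.
have : \sum_(y < t.+1) F (y + l)%N = \sum_(y < t.+1) F (y + l)%N by [].
rewrite {1}big_ord_recl big_ord_recr /= add0n [(t + l)%N]addnC per addrC => /addrI <-.
by apply: eq_bigr => y _; rewrite /bump /= addnS add1n addSn.
Qed.

(** The additive energy modulo p of the first L powers of lambda. *)
Definition energy (lambda L p : nat) : nat :=
  #|[pred q : ('I_L * 'I_L) * ('I_L * 'I_L) |
     lambda ^ q.1.1 + lambda ^ q.1.2 == lambda ^ q.2.1 + lambda ^ q.2.2 %[mod p]]|.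

Definition gauss_sum (R : realType) (lambda a p t b : nat) : R[i] :=
  \sum_(y < t) expi ((a * lambda ^ y)%:R / p%:R : R) * expi (- ((b * y)%:R / t%:R)).

(** For t > 0 this says that t is the multiplicative order of lambda modulo
    p. *)
Definition is_order (lambda p t : nat) :=
  forall x y, (lambda ^ x == lambda ^ y %[mod p]) = (x == y %[mod t]).

Lemma eqn_modMl_coprime (p a x y : nat) : coprime a p ->
  (a * x == a * y %[mod p]) = (x == y %[mod p]).
Proof.
move=> ap; wlog xy : x y / (x <= y)%N.
  by move=> W; case: (leqP x y) => [|/ltnW] /W //; rewrite eq_sym => ->; rewrite eq_sym.
have axy : (a * x <= a * y)%N by rewrite leq_mul.
rewrite eq_sym (eqn_mod_dvd p axy) eq_sym (eqn_mod_dvd p xy).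
by rewrite -mulnBr Gauss_dvdr // coprime_sym.
Qed.

(** The t points of the orbit of a are distinct residues modulo p. *)
Lemma sum_orbit_le (R : realType) (lambda a p t : nat) (g : nat -> R) :
  (0 < p)%N -> coprime a p -> is_order lambda p t -> (forall z, 0 <= g z) ->
  \sum_(y < t) g ((a * lambda ^ y) %% p)%N <= \sum_(z < p) g z.
Proof.
move=> p0 ap ot g0.
have -> : \sum_(y < t) g ((a * lambda ^ y) %% p)%N =
    \sum_(z <- [seq (a * lambda ^ y) %% p | y <- iota 0 t]%N) g z.
  by rewrite big_map -(big_mkord xpredT (fun y => g ((a * lambda ^ y) %% p)%N))
     /index_iota subn0.
apply: ler_sum_uniq => //; last first.
  by apply/allP => _ /mapP[y _ ->]; rewrite ltn_mod.
rewrite map_inj_in_uniq ?iota_uniq // => x y.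
rewrite !mem_iota !add0n /= => xt yt /eqP.
by rewrite eqn_modMl_coprime // ot => /eqP; rewrite !modn_small.
Qed.


(** The summand of the Gauss sum has period t, so each shift of y by l < L
    leaves the sum unchanged; averaging over these shifts produces short sums
    over l attached to the points of the orbit. *)
Lemma gauss_sum_smooth (R : realType) (lambda a p t b L : nat) :
  (0 < p)%N -> (0 < t)%N -> is_order lambda p t ->
  L%:R * normc (gauss_sum R lambda a p t b) <=
  \sum_(y < t) normc (\sum_(l < L) expi (- ((b * l)%:R / t%:R : R)) *
       expi ((((a * lambda ^ y) %% p) * lambda ^ l)%:R / p%:R)).
Proof.
move=> p0 t0 ot.
pose F x := expi ((a * lambda ^ x)%:R / p%:R : R) * expi (- ((b * x)%:R / t%:R)).
have per x : F (x + t)%N = F x.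
  rewrite /F; congr (_ * _).
    apply: expi_modn => //; rewrite -modnMmr; apply/eqP.
    have /eqP -> : lambda ^ (x + t) == lambda ^ x %[mod p] by rewrite ot modnDr.
    by rewrite modnMmr.
  rewrite -!conjc_expi; congr conjc; apply: expi_modn => //.
  by rewrite mulnDr addnC modnMDl.
have -> : L%:R * normc (gauss_sum R lambda a p t b) =
    normc (\sum_(l < L) \sum_(y < t) F (y + l)%N).
  under eq_bigr do rewrite sum_shift_periodic //.
  rewrite sumr_const card_ord -[X in _ = normc X]mulr_natl normcM; congr (_ * _).
  by rewrite -(rmorph_nat (real_complex R)) normc_real ger0_norm.
rewrite exchange_big /=; apply: le_trans (normc_sum _ _ _) _.
apply: ler_sum => y _; rewrite -[leRHS]mul1r.
rewrite -[X in _ <= X * _](normc_expi (- ((b * y)%:R / t%:R))) -normcM mulr_sumr.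
rewrite le_eqVlt; apply/orP; left; apply/eqP; congr normc.
apply: eq_bigr => l _; rewrite /F [RHS]mulrA -[X in _ = X * _]expiD mulrC; congr (_ * _).
  by congr expi; rewrite mulnDr natrD mulrDl opprD.
apply: expi_modn => //.
by rewrite modnMml expnD mulnA.
Qed.

Lemma card_le_fst (I J : finType) (Q : pred (I * J)) :
  (forall i j j', Q (i, j) -> Q (i, j') -> j = j') -> (#|Q| <= #|I|)%N.
Proof.
move=> h; rewrite -(card_in_imset (f := fst) (D := Q)) ?max_card //.
by move=> [i j] [i' j'] /= Qx Qy ii; subst i'; rewrite (h _ _ _ Qx Qy).
Qed.

(** Smoothing over a full period L = t, the mean square over all residues
    counts only the diagonal congruences. *)
Lemma sqr_gauss_sum_le (R : realType) (lambda a p t b : nat) :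
  (0 < p)%N -> (0 < t)%N -> is_order lambda p t -> coprime a p ->
  normc (gauss_sum R lambda a p t b) ^+ 2 <= p%:R.
Proof.
move=> p0 t0 ot ap; set g := normc _.
have tR : 0 < t%:R :> R by rewrite ltr0n.
pose B z := \sum_(l < t) expi (- ((b * l)%:R / t%:R : R)) *
       expi ((z * lambda ^ l)%:R / p%:R).
have h1 : t%:R * g <= \sum_(y < t) normc (B ((a * lambda ^ y) %% p)%N).
  exact: gauss_sum_smooth.
have h2 : \sum_(y < t) normc (B ((a * lambda ^ y) %% p)%N) ^+ 2 <= p%:R * t%:R.
  apply: le_trans (sum_orbit_le (g := fun z => normc (B z) ^+ 2) p0 ap ot _) _.
    by move=> z; apply: sqr_ge0.
  apply: le_trans (mean_square_le (fun l : 'I_t => lambda ^ l)%N p0 _) _.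
    by move=> l; rewrite normc_expi.
  rewrite ler_wpM2l // ler_nat -[X in (_ <= X)%N](card_ord t).
  apply: card_le_fst => i j j'; rewrite !inE /= !ot !modn_small // => /eqP e1 /eqP e2.
  by apply: val_inj; rewrite /= -e1 -e2.
have h3 : (t%:R * g) ^+ 2 <= t%:R * (p%:R * t%:R).
  have g0 : 0 <= t%:R * g by rewrite mulr_ge0 ?normc_ge0.
  apply: le_trans (_ : (\sum_(y < t) normc (B ((a * lambda ^ y) %% p)%N)) ^+ 2 <= _).
    by rewrite ler_sqr ?nnegrE // (le_trans g0).
  apply: le_trans (cauchy_schwarz_card _ _) _.
  by rewrite card_ord ler_wpM2l.
rewrite -(ler_pM2r (_ : 0 < t%:R ^+ 2)) ?exprn_gt0 //; move: h3; lra.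
Qed.

(** With the sum over l < L inside, the fourth moment over the orbit is at
    most the fourth moment over all residues, hence at most p times an additive
    energy. Only short progressions of exponents enter this energy, and it can
    be controlled on average over p; for t near the square root of p the
    resulting bound beats the square root of p by a power of p. *)
Lemma gauss_sum_energy (R : realType) (lambda a p t b L : nat) :
  (0 < p)%N -> (0 < t)%N -> is_order lambda p t -> coprime a p ->
  (L%:R * normc (gauss_sum R lambda a p t b)) ^+ 4 <=
  t%:R ^+ 3 * p%:R * (energy lambda L p)%:R.
Proof.
move=> p0 t0 ot ap; set g := normc _.
have tR : 0 < t%:R :> R by rewrite ltr0n.
pose B z := \sum_(l < L) expi (- ((b * l)%:R / t%:R : R)) *
       expi ((z * lambda ^ l)%:R / p%:R).
have h1 : L%:R * g <= \sum_(y < t) normc (B ((a * lambda ^ y) %% p)%N).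
  exact: gauss_sum_smooth.
have h2 : \sum_(y < t) normc (B ((a * lambda ^ y) %% p)%N) ^+ 4 <=
    p%:R * (energy lambda L p)%:R.
  apply: le_trans (sum_orbit_le (g := fun z => normc (B z) ^+ 4) p0 ap ot _) _.
    by move=> z; apply: exprn_ge0; apply: normc_ge0.
  pose w (x : 'I_L * 'I_L) := expi (- ((b * x.1)%:R / t%:R : R)) * expi (- ((b * x.2)%:R / t%:R : R)).
  have BB z : normc (B z) ^+ 4 =
     normc (\sum_x w x * expi ((z * (lambda ^ x.1 + lambda ^ x.2))%:R / p%:R : R)) ^+ 2.
    rewrite (exprM _ 2 2); congr (_ ^+ 2).
    rewrite expr2 -normcM; congr normc.
    rewrite /B mulr_suml.
    rewrite -(pair_bigA _ (fun l l' : 'I_L => w (l, l') * expi ((z * (lambda ^ l + lambda ^ l'))%:R / p%:R : R))) /=.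
    apply: eq_bigr => l _; rewrite mulr_sumr; apply: eq_bigr => l' _.
    rewrite /w /= mulrACA; congr (_ * _).
    by rewrite -expiD mulnDr natrD mulrDl.
  under eq_bigr do rewrite BB.
  apply: mean_square_le => // x.
  by rewrite normcM !normc_expi mulr1.
have g0 : 0 <= L%:R * g by rewrite mulr_ge0 ?normc_ge0.
set T := \sum_(y < t) normc (B ((a * lambda ^ y) %% p)%N) in h1.
set T2 := \sum_(y < t) normc (B ((a * lambda ^ y) %% p)%N) ^+ 2.
have c1 : T ^+ 2 <= t%:R * T2.
  by apply: le_trans (cauchy_schwarz_card _ _) _; rewrite card_ord.
have c2 : T2 ^+ 2 <= t%:R * (p%:R * (energy lambda L p)%:R).
  apply: le_trans (cauchy_schwarz_card _ _) _; rewrite card_ord ler_wpM2l //.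
  by under eq_bigr do rewrite -exprM.
apply: le_trans (_ : (T ^+ 2) ^+ 2 <= _).
  by rewrite -exprM lerXn2r ?nnegrE // (le_trans g0).
apply: le_trans (_ : (t%:R * T2) ^+ 2 <= _).
  have T20 : 0 <= t%:R * T2 by rewrite mulr_ge0 // sumr_ge0 // => y _; apply: sqr_ge0.
  by rewrite ler_sqr ?nnegrE ?sqr_ge0.
rewrite exprMn [leRHS](_ : _ = t%:R ^+ 2 * (t%:R * (p%:R * (energy lambda L p)%:R))); last by ring.
by rewrite ler_wpM2l // sqr_ge0.
Qed.

(** Expansion of the t-periodic function k |-> expi (a lambda^k / p) in the
    characters of Z / t. *)
Lemma fourier_inversion (R : realType) (lambda a p t k : nat) :
  (0 < p)%N -> (0 < t)%N -> is_order lambda p t ->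
  t%:R * expi ((a * lambda ^ k)%:R / p%:R : R) =
  \sum_(b < t) gauss_sum R lambda a p t b * expi (k%:R * (b%:R / t%:R)).
Proof.
move=> p0 t0 ot; rewrite /gauss_sum.
under eq_bigr do rewrite mulr_suml.
rewrite exchange_big /=.
have tR : t%:R != 0 :> R by rewrite pnatr_eq0 -lt0n.
transitivity (\sum_(y < t) expi ((a * lambda ^ y)%:R / p%:R : R) *
   (if (y == k %% t :> nat)%N then t%:R else 0)).
  rewrite (bigD1 (Ordinal (ltn_pmod k t0))) //= eqxx big1 ?addr0; last first.
    move=> y; rewrite -val_eqE /= => /negbTE ->; exact: mulr0.
  rewrite mulrC; congr (_ * _); apply: expi_modn => //.
  rewrite -modnMmr; apply/eqP.
  have /eqP -> : lambda ^ k == lambda ^ (k %% t) %[mod p] by rewrite ot modn_mod.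
  by rewrite modnMmr.
apply: eq_bigr => y _.
under eq_bigr do rewrite -mulrA.
rewrite -mulr_sumr; congr (_ * _).
transitivity (dirichlet t ((k%:Z - y%:Z)%:~R / t%:R : R)).
  rewrite sumr_dirichlet // -eqz_mod_dvd.
  rewrite !modz_nat eqz_nat (modn_small (ltn_ord y)) eq_sym.
  by case: ifP.
apply: eq_bigr => b _; rewrite -expiD; congr expi.
by rewrite intrB -!pmulrn natrM; field.
Qed.

(** * Orbit sums modulo one prime *)

(** Each fraction b / t with b < t is a reduced fraction whose denominator
    divides t, and each such reduced fraction occurs once. *)
Lemma sum_by_denominator (R : comPzRingType) (t : nat) (w : nat -> R) (f : nat -> nat -> R) :
  (0 < t)%N ->
  \sum_(b < t) w (t %/ gcdn b t)%N * f (b %/ gcdn b t)%N (t %/ gcdn b t)%N =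
  \sum_(d < t.+1 | (d %| t)%N) w d * \sum_(b < d | coprime b d) f b d.
Proof.
move=> t0.
pose den (b : 'I_t) : 'I_t.+1 := inord (t %/ gcdn b t).
have denE b : den b = (t %/ gcdn b t)%N :> nat.
  by rewrite inordK // ltnS leq_div.
rewrite (partition_big den (fun d => (d %| t)%N)) /=; last first.
  by move=> b _; rewrite denE dvdn_div ?dvdn_gcdr.
apply: eq_bigr => -[d ltd] /= dt.
have d0 : (0 < d)%N by rewrite (dvdn_gt0 t0 dt).
case/dvdnP: (dt) => k tE.
have k0 : (0 < k)%N by move: t0; rewrite tE muln_gt0 => /andP[].
rewrite mulr_sumr.
have hlt (b : 'I_d) : (b * k < t)%N by rewrite tE mulnC ltn_pmul2l.
pose h (b : 'I_d) : 'I_t := Ordinal (hlt b).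
have h'lt (b : 'I_t) : (b %/ k < d)%N by rewrite ltn_divLR // mulnC -tE.
pose h' (b : 'I_t) : 'I_d := Ordinal (h'lt b).
have gk (b : 'I_t) : (den b == Ordinal ltd) = (gcdn b t == k).
  rewrite -val_eqE /= denE; apply/eqP/eqP => [E|->].
    by apply/eqP; rewrite -(eqn_pmul2l d0) -{1}E divnK ?dvdn_gcdr // tE mulnC.
  by rewrite tE mulKn.
rewrite (reindex_onto h h') /=; last first.
  move=> b; rewrite gk => /eqP gE; apply: val_inj => /=.
  by rewrite divnK // -gE dvdn_gcdl.
have gE (b : 'I_d) : gcdn (b * k)%N t = (gcdn b d * k)%N by rewrite tE mulnC muln_gcdl mulnC [(k * d)%N]mulnC.
apply: eq_big => b.
  have -> : h' (h b) == b by apply/eqP; apply: val_inj; rewrite /= mulnK.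
  by rewrite andbT gk /= gE -{2}[k]mul1n eqn_pmul2r.
move=> /andP[]; rewrite gk /= => /eqP -> _.
by rewrite mulnK // {1 2}tE mulKn.
Qed.

Lemma cauchy_schwarz_weight (R : realType) (I : finType) (P : pred I) (x v : I -> R) :
  (forall i, 0 < v i) ->
  (\sum_(i | P i) x i) ^+ 2 <= (\sum_(i | P i) v i) * \sum_(i | P i) x i ^+ 2 / v i.
Proof.
move=> v0.
have := cauchy_schwarz (index_enum I) P (fun i => Num.sqrt (v i)) (fun i => x i / Num.sqrt (v i)).
have s0 i : Num.sqrt (v i) != 0 by rewrite sqrtr_eq0 -ltNge.
under eq_bigr do rewrite mulrC divfK //.
under [X in _ <= X * _]eq_bigr do rewrite sqr_sqrtr ?ltW //.
by under [X in _ <= _ * X]eq_bigr do rewrite exprMn exprVn sqr_sqrtr ?ltW //.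
Qed.

(** Expand in characters of Z / t and group the frequencies b / t by their
    denominators d. For d >= D, Cauchy-Schwarz is applied with the bound p for
    every squared Gauss sum. For d < D it is applied with the weights 1 / d,
    whose total is at most the number of divisors of t; this is what replaces
    the factor 1 / t by d / t ^ 2. *)
Lemma orbit_sum_bound (R : realType) (ss : seq nat) (lambda a p t D : nat) (Gam : R) :
  (0 < p)%N -> (0 < t)%N -> is_order lambda p t -> coprime a p ->
  (forall b, normc (gauss_sum R lambda a p t b) ^+ 2 <= Gam) ->
  normc (\sum_(k <- ss) expi ((a * lambda ^ k)%:R / p%:R : R)) ^+ 2 <=
  2 * (p%:R / t%:R) * \sum_(d < t.+1 | (d %| t)%N && (D <= d)%N) farey_sum R ss d +
  2 * ((size (divisors t))%:R * Gam / t%:R ^+ 2) *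
    \sum_(d < t.+1 | (d %| t)%N && (d < D)%N) d%:R * farey_sum R ss d.
Proof.
move=> p0 t0 ot ap hG; set sg := \sum_(k <- ss) _.
have tR : 0 < t%:R :> R by rewrite ltr0n.
pose G b := gauss_sum R lambda a p t b.
pose A (b : nat) := \sum_(k <- ss) expi (k%:R * (b%:R / t%:R) : R).
pose den (b : nat) := (t %/ gcdn b t)%N.
have den0 b : (0 < den b)%N.
  by rewrite divn_gt0 ?gcdn_gt0 ?t0 ?orbT // dvdn_leq // dvdn_gcdr.
have sE : t%:R * sg = \sum_(b < t) G b * A b.
  rewrite /sg mulr_sumr.
  under eq_bigr do rewrite fourier_inversion //.
  by rewrite exchange_big /=; apply: eq_bigr => b _; rewrite mulr_sumr.
pose x b := normc (G b) * normc (A b).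
pose X1 := \sum_(b < t | (D <= den b)%N) x b.
pose X2 := \sum_(b < t | (den b < D)%N) x b.
have x0 b : 0 <= x b by rewrite mulr_ge0 ?normc_ge0.
have le12 : (t%:R * normc sg) ^+ 2 <= 2 * X1 ^+ 2 + 2 * X2 ^+ 2.
  have X10 : 0 <= X1 by apply: sumr_ge0.
  have X20 : 0 <= X2 by apply: sumr_ge0.
  have : t%:R * normc sg <= X1 + X2.
    have -> : t%:R * normc sg = normc (t%:R * sg).
      by rewrite normcM -(rmorph_nat (real_complex R)) normc_real ger0_norm.
    rewrite sE; apply: le_trans (normc_sum _ _ _) _.
    rewrite (bigID (fun b : 'I_t => (D <= den b)%N)) /=; apply: lerD.
      by apply: ler_sum => b _; rewrite normcM.
    rewrite /X2 le_eqVlt; apply/orP; left; apply/eqP.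
    by apply: eq_big => b; [rewrite -ltnNge|rewrite normcM].
  have : 0 <= t%:R * normc sg by rewrite mulr_ge0 ?normc_ge0.
  set y := t%:R * _ => y0 hy.
  apply: le_trans (_ : (X1 + X2) ^+ 2 <= _).
    by rewrite ler_sqr ?nnegrE // (le_trans y0).
  by have := sqr_ge0 (X1 - X2); nra.
pose f b d := normc (\sum_(k <- ss) expi (k%:R * (b%:R / d%:R) : R)) ^+ 2.
have Af (b : nat) : normc (A b) ^+ 2 = f (b %/ gcdn b t)%N (den b).
  rewrite /A /f /den.
  have g0 : (gcdn b t)%:R != 0 :> R by rewrite pnatr_eq0 -lt0n gcdn_gt0 t0 orbT.
  have bE : b%:R = (b %/ gcdn b t)%:R * (gcdn b t)%:R :> R.
    by rewrite -natrM divnK ?dvdn_gcdl.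
  have tE : t%:R = (t %/ gcdn b t)%:R * (gcdn b t)%:R :> R.
    by rewrite -natrM divnK ?dvdn_gcdr.
  have d0 : (t %/ gcdn b t)%:R != 0 :> R by rewrite pnatr_eq0 -lt0n den0.
  congr (normc _ ^+ 2); apply: eq_bigr => k _; congr (expi (_ * _)).
  rewrite {1}bE {1}tE; field; exact/andP.
have byden (w : nat -> R) (Q : pred nat) :
    \sum_(b < t | Q (den b)) w (den b) * normc (A b) ^+ 2 =
    \sum_(d < t.+1 | (d %| t)%N && Q d) w d * farey_sum R ss d.
  have E := sum_by_denominator (fun d => if Q d then w d else 0) f t0.
  rewrite big_mkcond [RHS]big_mkcondr /=.
  transitivity (\sum_(b < t) (if Q (den b) then w (den b) else 0) *
      f (b %/ gcdn b t)%N (den b)).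
    by apply: eq_bigr => b _; rewrite Af; case: ifP; rewrite ?mul0r.
  by rewrite E; apply: eq_bigr => d _; case: ifP; rewrite ?mul0r.
have X1le : X1 ^+ 2 <= t%:R * p%:R *
     \sum_(d < t.+1 | (d %| t)%N && (D <= d)%N) farey_sum R ss d.
  apply: le_trans (cauchy_schwarz _ _ _ _) _.
  apply: ler_pM; try by apply: sumr_ge0 => b _; apply: sqr_ge0.
    apply: le_trans (_ : \sum_(b < t | (D <= den b)%N) p%:R <= _).
      by apply: ler_sum => b _; apply: sqr_gauss_sum_le.
    rewrite sumr_const -[leLHS]mulr_natl ler_wpM2r // ler_nat.
    by rewrite -[X in (_ <= X)%N](card_ord t) max_card.
  rewrite le_eqVlt; apply/orP; left; apply/eqP.
  transitivity (\sum_(b < t | (D <= den b)%N) 1 * normc (A b) ^+ 2).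
    by apply: eq_bigr => b _; rewrite mul1r.
  rewrite (byden (fun=> 1) (fun d => D <= d)%N).
  by apply: eq_bigr => d _; rewrite mul1r.
have X2le : X2 ^+ 2 <= (size (divisors t))%:R * (Gam *
     \sum_(d < t.+1 | (d %| t)%N && (d < D)%N) d%:R * farey_sum R ss d).
  have v0 (b : 'I_t) : 0 < (den b)%:R^-1 :> R by rewrite invr_gt0 ltr0n.
  apply: le_trans (cauchy_schwarz_weight _ _ v0) _.
  apply: ler_pM.
  - by apply: sumr_ge0 => b _; rewrite ltW.
  - by apply: sumr_ge0 => b _; rewrite mulr_ge0 ?sqr_ge0 // invrK.
  - apply: le_trans (_ : \sum_(b < t) (den b)%:R^-1 * 1 <= _).
      under [leRHS]eq_bigr do rewrite mulr1.
      rewrite [leRHS](bigID (fun b : 'I_t => (den b < D)%N)) /= lerDl.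
      by apply: sumr_ge0 => b _; rewrite ltW.
    rewrite (sum_by_denominator (fun d => d%:R^-1) (fun _ _ => 1) t0).
    apply: le_trans (_ : \sum_(d < t.+1 | (d %| t)%N) 1 <= _).
      apply: ler_sum => d dt; rewrite sumr_const.
      have d0 : (0 < d)%N := dvdn_gt0 t0 dt.
      rewrite mulrC ler_pdivrMr ?ltr0n // mul1r ler_nat.
      by rewrite -[X in (_ <= X)%N](card_ord d) max_card.
    rewrite sumr_const ler_nat.
    rewrite -(size_image (fun d : 'I_t.+1 => (d : nat)) (fun d : 'I_t.+1 => (d %| t)%N)).
    apply: uniq_leq_size.
      by rewrite map_inj_uniq ?enum_uniq //; apply: val_inj.
    by move=> _ /mapP[d + ->]; rewrite mem_enum unfold_in -dvdn_divisors.
  - apply: le_trans (_ : Gam * \sum_(b < t | (den b < D)%N) (den b)%:R * normc (A b) ^+ 2 <= _).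
      rewrite mulr_sumr; apply: ler_sum => b _; rewrite invrK /x exprMn -mulrA (mulrC _ (den b)%:R).
      by rewrite ler_wpM2r ?hG // mulr_ge0 ?sqr_ge0 //.
    have G0 : 0 <= Gam by apply: le_trans (hG 0%N); apply: sqr_ge0.
    by rewrite ler_wpM2l // (byden (fun d => d%:R) (fun d => (d < D)%N)).
set S1 := \sum_(d < t.+1 | _) _ in X1le *.
set S2 := \sum_(d < t.+1 | _) _ in X2le *.
rewrite -(ler_pM2l (_ : 0 < t%:R ^+ 2)) ?exprn_gt0 // -exprMn.
apply: le_trans le12 _.
have -> : t%:R ^+ 2 * (2 * (p%:R / t%:R) * S1 + 2 * ((size (divisors t))%:R * Gam / t%:R ^+ 2) * S2)
  = 2 * (t%:R * p%:R * S1) + 2 * ((size (divisors t))%:R * (Gam * S2)).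
  by field; apply: lt0r_neq0.
by apply: lerD; rewrite ler_wpM2l.
Qed.

(** * Counting primes *)

Local Open Scope nat_scope.

(** Distinct prime divisors can be divided out one after the other, and each
    is at least 2. *)
Lemma leq_exp2_primes (s : seq nat) (m : nat) :
  uniq s -> (forall p, p \in s -> prime p && (p %| m)) -> 0 < m ->
  2 ^ size s <= m.
Proof.
elim: s m => [|p s IH] m /=; first by rewrite expn0.
move=> /andP[ps us] h m0.
have /andP[pp pm] := h p (mem_head _ _).
case/dvdnP: pm => m' mE.
have m'0 : 0 < m' by move: m0; rewrite mE muln_gt0 => /andP[].
have : 2 ^ size s <= m'.
  apply: IH => // q qs.
  have /andP[pq] := h q (mem_behead (s := p :: s) qs).
  rewrite pq mE Euclid_dvdM // => /orP[//|].
  by rewrite dvdn_prime2 // => /eqP qp; move: ps; rewrite -qp qs.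
rewrite mE expnS mulnC => le; apply: leq_mul => //.
exact: prime_gt1.
Qed.

(** The multiplicative order, as the first witness of a bounded search; the
    bound p suffices by Fermat's little theorem. *)
Definition mord (lambda p : nat) : nat :=
  find (fun t => (0 < t) && (lambda ^ t == 1 %[mod p])) (iota 0 p).

Lemma mord_spec (lambda p : nat) : prime p -> coprime lambda p ->
  [/\ 0 < mord lambda p, mord lambda p %| p.-1 & is_order lambda p (mord lambda p)].
Proof.
move=> pp cop; set t := mord _ _.
pose Q t := (0 < t) && (lambda ^ t == 1 %[mod p]).
have p1 : 0 < p.-1 by have := prime_gt1 pp; case: (p) => [|[]].
have Qp : Q p.-1.
  rewrite /Q p1 -(eqn_modMl_coprime _ _ cop) -expnS prednK ?prime_gt0 // muln1.
  by apply/eqP; apply: fermat_little.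
have has : has Q (iota 0 p).
  by apply/hasP; exists p.-1 => //; rewrite mem_iota add0n /= prednK ?prime_gt0.
have tp : t < p by rewrite -[X in _ < X](size_iota 0 p) -has_find.
have /andP[t0 /eqP t1] : Q t by have := nth_find 0 has; rewrite -/t nth_iota.
have tmin n : n < t -> 0 < n -> lambda ^ n != 1 %[mod p].
  move=> nt n0; have := before_find 0 nt.
  by rewrite nth_iota ?(ltn_trans nt) // add0n n0 /= => /negbT.
have one n : (lambda ^ n == 1 %[mod p]) = (t %| n).
  have -> : (lambda ^ n == 1 %[mod p]) = (lambda ^ (n %% t) == 1 %[mod p]).
    rewrite {1}(divn_eq n t) expnD mulnC [n %/ t * t]mulnC expnM.
    by rewrite -modnMmr -modnXm t1 modnXm exp1n modnMmr muln1.
  rewrite /dvdn; case: (posnP (n %% t)) => [->|h]; first by rewrite expn0 eqxx.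
  by rewrite (negbTE (tmin _ (ltn_pmod n t0) h)); case: (n %% t) h.
have ot : is_order lambda p t.
  move=> x y; wlog xy : x y / x <= y.
    by move=> W; case: (leqP x y) => [|/ltnW] /W //; rewrite eq_sym => ->; rewrite eq_sym.
  rewrite [RHS]eq_sym (eqn_mod_dvd t xy) -one eq_sym.
  rewrite -{1}(subnKC xy) expnD -[X in _ == X %[mod p]]muln1 eqn_modMl_coprime //.
  by rewrite coprimeXl.
by split => //; rewrite -one; case/andP: Qp.
Qed.

(** Every prime with order at most T divides one of the numbers lambda ^ t - 1
    with t <= T, and their product has O(T ^ 2) binary digits. *)
Lemma small_order_count (lambda T : nat) (s : seq nat) :
  2 <= lambda -> uniq s ->
  (forall p, p \in s -> [&& prime p, coprime lambda p & mord lambda p <= T]) ->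
  size s <= lambda * T ^ 2.
Proof.
move=> l2 us h.
have l0 : 0 < lambda by apply: leq_trans l2.
pose M := \prod_(1 <= t < T.+1) (lambda ^ t - 1).
have M0 : 0 < M.
  rewrite /M big_nat_cond; elim/big_ind: _ => // [a b|t /andP[/andP[t1 _] _]].
    by rewrite muln_gt0 => -> ->.
  by rewrite subn_gt0 -[X in X < _](expn0 lambda) ltn_exp2l.
have ML : M <= 2 ^ (lambda * T ^ 2).
  apply: leq_trans (_ : \prod_(1 <= t < T.+1) 2 ^ (lambda * T) <= _).
    rewrite /M big_nat_cond [X in _ <= X]big_nat_cond.
    apply: leq_prod => t /andP[/andP[t1 tT] _].
    apply: leq_trans (leq_subr _ _) _.
    rewrite expnM; apply: leq_trans (_ : (2 ^ lambda) ^ t <= _).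
      by rewrite leq_exp2r // ltnW // ltn_expl.
    by rewrite leq_exp2l // (leq_trans l2) // ltnW // ltn_expl.
  by rewrite prod_nat_const_nat subn1 /= -expnM -mulnA mulnn.
rewrite -(leq_exp2l (m := 2)) //; apply: leq_trans ML.
apply: leq_exp2_primes => // p /h /and3P[pp cp tT].
rewrite pp /=; have [t0 _ ot] := mord_spec pp cp.
rewrite /M (big_cat_nat (n := mord lambda p)) //=; last exact: leqW.
rewrite [X in _ %| _ * X]big_ltn ?ltnS // dvdn_mull // dvdn_mulr //.
rewrite -eqn_mod_dvd ?expn_gt0 ?l0 //.
by rewrite -[X in _ == X %[mod p]](expn0 lambda) ot modnn mod0n.
Qed.

(** The larger exponents agree, because lambda ^ x + lambda ^ y is at most
    lambda ^ (max x y).+1 when lambda >= 2. *)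
Lemma sum_two_powers_inj (lambda a b c d : nat) : 2 <= lambda ->
  lambda ^ a + lambda ^ b = lambda ^ c + lambda ^ d ->
  (a = c /\ b = d) \/ (a = d /\ b = c).
Proof.
move=> l2.
have l0 : 0 < lambda by apply: leq_trans l2.
have lt x y z u : x <= y -> y < u -> lambda ^ x + lambda ^ y < lambda ^ z + lambda ^ u.
  move=> xy yu; apply: leq_ltn_trans (_ : lambda ^ u < _).
    apply: leq_trans (_ : lambda ^ y.+1 <= _); last by rewrite leq_exp2l.
    rewrite expnS; apply: leq_trans (_ : 2 * lambda ^ y <= _); last by rewrite leq_mul2r l2 orbT.
    by rewrite mul2n -addnn leq_add2r leq_exp2l.
  by rewrite -[X in X < _]add0n ltn_add2r expn_gt0 l0.
have main x y z u : x <= y -> z <= u -> lambda ^ x + lambda ^ y = lambda ^ z + lambda ^ u ->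
    x = z /\ y = u.
  move=> xy zu E; have yu : y = u.
    case: (ltngtP y u) => // h.
      by have := lt x y z u xy h; rewrite E ltnn.
    by have := lt z u x y zu h; rewrite E ltnn.
  split=> //; move: E; rewrite yu => /eqP; rewrite eqn_add2r eqn_exp2l // => /eqP //.
move=> E; case: (leqP a b) => [|/ltnW] h1; case: (leqP c d) => [|/ltnW] h2.
- by left; apply: main.
- by right; apply: main; rewrite // E addnC.
- by right; rewrite addnC in E; have [] := main _ _ _ _ h1 h2 E.
- by left; rewrite addnC [RHS]addnC in E; have [] := main _ _ _ _ h1 h2 E.
Qed.

(** Quadruples whose two sums agree as integers come from equal pairs, up to
    order, and are counted for every p. For any other quadruple the difference
    of the sums is a non-zero integer with O(L) binary digits, hence with O(L)
    prime divisors. *)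
Lemma sum_energy_le (lambda L : nat) (s : seq nat) :
  2 <= lambda -> uniq s -> (forall p, p \in s -> prime p) ->
  \sum_(p <- s) energy lambda L p <= size s * (2 * L ^ 2) + L ^ 4 * (lambda * L + 1).
Proof.
move=> l2 us sp.
have l0 : 0 < lambda by apply: leq_trans l2.
pose u (x : 'I_L * 'I_L) := lambda ^ x.1 + lambda ^ x.2.
under eq_bigr do rewrite /energy -sum1_card big_mkcond.
rewrite exchange_big /=.
pose diag (q : ('I_L * 'I_L) * ('I_L * 'I_L)) := u q.1 == u q.2.
rewrite (bigID diag) /=; apply: leq_add.
  apply: leq_trans (_ : \sum_(q | diag q) size s <= _).
    apply: leq_sum => q _; rewrite -sum1_size; apply: leq_sum => p _.
    by case: ifP.
  rewrite sum_nat_const mulnC leq_mul2l; apply/orP; right.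
  pose g (q : ('I_L * 'I_L) * ('I_L * 'I_L)) := (q.1, q.1.1 == q.2.1).
  rewrite -(card_in_imset (f := g)) /=; last first.
    move=> [[a b] [c d]] [[a' b'] [c' d']]; rewrite !unfold_in /diag /u /=.
    move=> /eqP E /eqP E' [e1 e2 e3]; subst a' b'.
    suff [-> ->] : c = c' /\ d = d' by [].
    have [[h1 h2]|[h1 h2]] := sum_two_powers_inj l2 E;
    have [[h3 h4]|[h3 h4]] := sum_two_powers_inj l2 E'.
    - by split; apply: val_inj; rewrite /= -?h1 -?h3 -?h2 -?h4.
    - have ac : a = c by apply: val_inj.
      have ac' : a = c' by apply/eqP; rewrite -e3 ac.
      by split; apply: val_inj; rewrite /= -?ac' -?ac // -h2 h4 -ac' h3.
    - have ac : a = c' by apply: val_inj.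
      have ac' : a = c by apply/eqP; rewrite e3 ac.
      by split; apply: val_inj; rewrite /= -?ac' -?ac // -h4 h2 -ac' h1.
    - by split; apply: val_inj; rewrite /= -?h1 -?h3 -?h2 -?h4.
  apply: leq_trans (max_card _) _.
  by rewrite !card_prod !card_ord card_bool mulnC -mulnn.
apply: leq_trans (_ : \sum_(q | ~~ diag q) (lambda * L + 1) <= _).
  apply: leq_sum => q nq.
  have -> : \sum_(i <- s) (if q \in [pred q0 | u q0.1 == u q0.2 %[mod i]] then 1 else 0)
     = size [seq i <- s | u q.1 == u q.2 %[mod i]].
    by rewrite size_filter -big_mkcond sum1_count.
  have ub x : u x <= 2 ^ (lambda * L + 1).
    have L0 : 0 < L by apply: leq_ltn_trans (ltn_ord x.1).
    have le (i : 'I_L) : lambda ^ i <= 2 ^ (lambda * L).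
      apply: leq_trans (_ : lambda ^ L <= _); first by rewrite leq_exp2l // ltnW.
      by rewrite expnM leq_exp2r // ltnW // ltn_expl.
    by rewrite /u addn1 expnS mul2n -addnn; apply: leq_add; apply: le.
  wlog lt : q nq / u q.1 < u q.2.
    move=> W; move: nq; rewrite /diag neq_ltn => /orP[|] lt; first by apply: W; rewrite // /diag neq_ltn lt.
    have := W (q.2, q.1); rewrite /diag /= neq_ltn lt => /(_ isT isT).
    by congr (size _ <= _); apply: eq_filter => i; rewrite eq_sym.
  rewrite -(leq_exp2l (m := 2)) //; apply: leq_trans (_ : u q.2 - u q.1 <= _).
    apply: leq_exp2_primes; first by rewrite filter_uniq.
      move=> p; rewrite mem_filter => /andP[E ps]; rewrite sp //=.
      by rewrite -(eqn_mod_dvd p (ltnW lt)) eq_sym.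
    by rewrite subn_gt0.
  exact: leq_trans (leq_subr _ _) (ub _).
rewrite sum_nat_const leq_mul2r; apply/orP; right.
apply: leq_trans (max_card _) _.
by rewrite !card_prod !card_ord !mulnA !expnS expn0 muln1 !mulnA.
Qed.

Lemma primes_1mod_count (d n : nat) (s : seq nat) : 0 < d -> uniq s ->
  (forall p, p \in s -> prime p && (p <= n)) ->
  count (fun p => d %| p.-1) s <= n %/ d.
Proof.
move=> d0 us h; rewrite -size_filter.
rewrite -(size_map (fun p => p.-1 %/ d)) -[X in _ <= X](size_iota 1).
apply: uniq_leq_size.
  rewrite map_inj_in_uniq ?filter_uniq // => p q.
  rewrite !mem_filter => /andP[dp ps] /andP[dq qs] E.
  have /andP[pp _] := h _ ps; have /andP[pq _] := h _ qs.
  by rewrite -(prednK (prime_gt0 pp)) -(prednK (prime_gt0 pq)) -(divnK dp) E divnK.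
move=> _ /mapP[p + ->]; rewrite mem_filter => /andP[dp ps].
have /andP[pp pn] := h _ ps.
have p1 : 0 < p.-1 by have := prime_gt1 pp; case: (p) => [|[]].
rewrite mem_iota add1n ltnS divn_gt0 // dvdn_leq //=.
by apply: leq_div2r; apply: leq_trans pn; apply: leq_pred.
Qed.

(** Double counting of the pairs (d, p) with d dividing p - 1. *)
Lemma sum_divisors_le (n : nat) (s : seq nat) : uniq s ->
  (forall p, p \in s -> prime p && (p <= n)) ->
  \sum_(p <- s) size (divisors p.-1) <= \sum_(1 <= d < n.+1) n %/ d.
Proof.
move=> us h.
have E p : p \in s -> size (divisors p.-1) <= \sum_(1 <= d < n.+1) (d %| p.-1).
  move=> ps; have /andP[pp pn] := h _ ps.
  have p1 : 0 < p.-1 by have := prime_gt1 pp; case: (p) => [|[]].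
  have -> : \sum_(1 <= d < n.+1) (d %| p.-1) = size [seq d <- index_iota 1 n.+1 | d %| p.-1].
    by rewrite size_filter -sum1_count [RHS]big_mkcond; apply: eq_bigr => d _; case: ifP.
  apply: uniq_leq_size; first exact: divisors_uniq.
  move=> d; rewrite -dvdn_divisors // => dp.
  rewrite mem_filter dp mem_index_iota (dvdn_gt0 p1 dp) ltnS /=.
  by apply: leq_trans (dvdn_leq p1 dp) (leq_trans (leq_pred _) pn).
rewrite big_seq; apply: leq_trans (leq_sum _ E) _.
rewrite -big_seq exchange_big /= big_nat_cond [X in _ <= X]big_nat_cond.
apply: leq_sum => d /andP[/andP[d1 _] _].
apply: leq_trans (primes_1mod_count d1 us h).
by rewrite -sum1_count [X in _ <= X]big_mkcond leq_sum // => p _; case: ifP.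
Qed.

(** By Vandermonde's identity the central coefficient is the sum of the squares
    of the coefficients 'C(n, j), whose sum is 2 ^ n. *)
Lemma exp2_le_central_bin (n : nat) : 2 ^ n <= 'C(n + n, n).
Proof.
rewrite -binomial.Vandermonde -[2]/(1 + 1) expnDn; apply: leq_sum => j _.
rewrite !exp1n !muln1 leq_pmulr // bin_gt0; exact: leq_subr.
Qed.

(** In Legendre's formula the power p ^ k contributes at most 1 to the exponent
    of p, and nothing when p ^ k > 2 n. *)
Lemma logn_central_bin (p n : nat) : prime p -> 0 < n ->
  p ^ logn p 'C(n + n, n) <= n + n.
Proof.
move=> pp n0; have p1 := prime_gt1 pp.
apply: leq_trans (trunc_logP p1 (_ : 0 < n + n)); last by rewrite addn_gt0 n0.
rewrite leq_exp2l //; set T := trunc_log p (n + n).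
have E : logn p (n + n)`! = logn p 'C(n + n, n) + (logn p n`! + logn p n`!).
  rewrite -(bin_fact (leq_addr n n)) addnK lognM ?muln_gt0 ?fact_gt0 //.
    by rewrite lognM ?fact_gt0.
  by rewrite bin_gt0 leq_addr.
have En : logn p n`! = \sum_(1 <= k < (n + n).+1) n %/ p ^ k.
  have z : \sum_(n.+1 <= k < (n + n).+1) n %/ p ^ k = 0.
    rewrite big_nat_cond big1 // => k /andP[/andP[nk _] _].
    by rewrite divn_small // (leq_trans nk) // ltnW // ltn_expl.
  by rewrite logn_fact // [RHS](big_cat_nat (n := n.+1)) ?z ?ltnS ?leq_addr // [RHS]addn0.
move: E; rewrite En logn_fact // => E.
rewrite -(leq_add2r (\sum_(1 <= k < (n + n).+1) n %/ p ^ k + \sum_(1 <= k < (n + n).+1) n %/ p ^ k)) -E.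
apply: leq_trans (_ : \sum_(1 <= k < (n + n).+1) ((p ^ k <= n + n) + (n %/ p ^ k + n %/ p ^ k)) <= _).
  apply: leq_sum => k _; case: (leqP (p ^ k) (n + n)) => h; last by rewrite divn_small.
  have q0 : 0 < p ^ k by rewrite expn_gt0 prime_gt0.
  rewrite -ltnS ltn_divLR //.
  by have := ltn_ceil n q0; move: (p ^ k) (n %/ p ^ k) => q r; nia.
rewrite !big_split /= leq_add2r.
apply: leq_trans (_ : size [seq k <- index_iota 1 (n + n).+1 | p ^ k <= n + n] <= _).
  by rewrite size_filter -sum1_count [X in _ <= X]big_mkcond leq_sum // => k _; case: ifP.
rewrite -[X in _ <= X](size_iota 1); apply: uniq_leq_size.
  by rewrite filter_uniq ?iota_uniq.
move=> k; rewrite mem_filter mem_index_iota mem_iota add1n ltnS => /andP[h /andP[-> _]] /=.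
exact: trunc_log_max.
Qed.

(** Chebyshev's argument: every prime power exactly dividing the central
    binomial coefficient is at most 2 n. *)
Lemma exp2_le_primes (n : nat) : 0 < n ->
  2 ^ n <= (n + n) ^ size [seq p <- iota 1 (n + n) | prime p].
Proof.
move=> n0; apply: leq_trans (exp2_le_central_bin n) _.
have C0 : 0 < 'C(n + n, n) by rewrite bin_gt0 leq_addr.
rewrite [X in X <= _](prod_prime_decomp C0) prime_decompE big_map /=.
apply: leq_trans (_ : \prod_(p <- primes 'C(n + n, n)) (n + n) <= _).
  rewrite big_seq [X in _ <= X]big_seq; apply: leq_prod => p.
  by rewrite mem_primes => /and3P[pp _ _]; apply: logn_central_bin.
rewrite big_const_seq count_predT iter_muln_1.
rewrite leq_exp2l; last by rewrite -(prednK n0) addSn addnS.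
apply: uniq_leq_size; first exact: primes_uniq.
move=> p; rewrite mem_primes => /and3P[pp _ pC].
rewrite mem_filter pp mem_iota prime_gt0 //= add1n ltnS.
rewrite leqNgt; apply/negP => h.
have : 0 < logn p (n + n)`!.
  by rewrite logn_gt0 mem_primes pp fact_gt0 -(bin_fact (leq_addr n n)) dvdn_mulr.
rewrite logn_fact // big_nat_cond big1 // => k /andP[/andP[k1 _] _].
rewrite divn_small // (leq_trans h) // -[X in X <= _]expn1.
by rewrite leq_exp2l ?prime_gt1.
Qed.

Local Open Scope ring_scope.

(** * Orbit sums on average over primes *)

(** By the large sieve each dyadic block of denominators contributes the same
    amount, so the whole range costs only the number J of blocks. *)
Lemma farey_sum_dyadic (R : realType) (ss : seq nat) (S D J : nat) :
  uniq ss -> all (fun k => k < S)%N ss -> (0 < D)%N ->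
  \sum_(d < D * 2 ^ J | (D <= d)%N) farey_sum R ss d / d%:R ^+ 2 <=
  J%:R * (8 * (4 + S%:R / D%:R ^+ 2) * (size ss)%:R).
Proof.
move=> us ltS D0; have DR : 0 < D%:R :> R by rewrite ltr0n.
elim: J => [|J IH].
  rewrite muln1 mul0r big1 // => d Dd.
  by have := ltn_ord d; rewrite ltnNge Dd.
set B := (D * 2 ^ J)%N.
have B0 : (0 < B)%N by rewrite muln_gt0 D0 expn_gt0.
have BR : 0 < B%:R :> R by rewrite ltr0n.
have BB : (D * 2 ^ J.+1 = 2 * B)%N by rewrite /B expnS mulnCA.
have DB : D%:R <= B%:R :> R by rewrite ler_nat /B leq_pmulr // expn_gt0.
rewrite BB (bigID (fun d : 'I__ => (d < B)%N)) /= -natr1 mulrDl mul1r.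
apply: lerD.
  rewrite -/B in IH; apply: le_trans IH.
  rewrite (big_ord_widen_cond (2 * B) (fun d => D <= d)%N (fun d => farey_sum R ss d / d%:R ^+ 2)) //.
  by rewrite mul2n -addnn leq_addr.
apply: le_trans (_ : \sum_(d < 2 * B) farey_sum R ss d / B%:R ^+ 2 <= _).
  rewrite big_mkcond; apply: ler_sum => d _; case: ifP => [/andP[_ dB]|_]; last first.
    by rewrite mulr_ge0 ?farey_sum_ge0 // invr_ge0 sqr_ge0.
  rewrite ler_wpM2l ?farey_sum_ge0 //; rewrite -leqNgt in dB.
  have dR : 0 < d%:R :> R by rewrite ltr0n (leq_trans B0).
  by rewrite lef_pV2 ?posrE ?exprn_gt0 // ler_sqr ?nnegrE // ler_nat.
rewrite -mulr_suml ler_pdivrMr ?exprn_gt0 //.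
apply: le_trans (_ : \sum_(d < (2 * B).+1) farey_sum R ss d <= _).
  by rewrite [leRHS]big_ord_recr /= lerDl farey_sum_ge0.
apply: le_trans (large_sieve R (2 * B) us ltS) _.
rewrite [leRHS]mulrAC ler_wpM2r // -[leRHS]mulrA ler_wpM2l // [leRHS]mulrDl [leLHS]addrC.
apply: lerD; first by rewrite natrM exprMn expr2 -natrM.
rewrite [leRHS]mulrAC ler_pdivlMr ?exprn_gt0 //.
by rewrite ler_wpM2l // ler_sqr ?nnegrE.
Qed.

Lemma sum_primes_dvd_pred (R : numDomainType) (n : nat) (s : seq nat) (g : nat -> R) (m : nat) :
  uniq s -> (forall p, p \in s -> prime p && (p <= n)%N) -> (forall d, 0 <= g d) ->
  \sum_(p <- s) \sum_(d < m | (0 < d)%N && (d %| p.-1)%N) g d <=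
  \sum_(d < m | (0 < d)%N) (n %/ d)%:R * g d.
Proof.
move=> us hs g0; under eq_bigr do rewrite big_mkcondr.
rewrite exchange_big /=; apply: ler_sum => d d0.
rewrite -big_mkcond big_const_seq iter_addr_0 -[leLHS]mulr_natl ler_wpM2r //.
by rewrite ler_nat; apply: primes_1mod_count.
Qed.

(** The two parts of orbit_sum_bound are summed over p. For a denominator
    d >= D one has p / t <= n / d, since d divides t, and at most n / d of the
    primes are congruent to 1 modulo d; together these give the weight
    n ^ 2 / d ^ 2 of farey_sum_dyadic. For d < D the factor d of the bound
    cancels the density 1 / d of the same primes. The last hypothesis on p says
    that the bound of gauss_sum_energy, multiplied by the number of divisors of
    t and divided by t ^ 2, is at most Y. *)
Lemma sum_orbit_sqr_le (R : realType) (lambda n S D J L : nat) (ss s : seq nat)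
    (a : nat -> nat) (Y : R) :
  uniq ss -> all (fun k => k < S)%N ss -> (0 < D)%N -> (n < D * 2 ^ J)%N ->
  (0 < L)%N -> 0 <= Y -> uniq s ->
  (forall p, p \in s -> [&& prime p, (p <= n)%N, coprime lambda p & coprime (a p) p]) ->
  (forall p, p \in s ->
     (size (divisors (mord lambda p)))%:R ^+ 2 * (p%:R * (energy lambda L p)%:R) <=
     Y ^+ 2 * (mord lambda p)%:R * L%:R ^+ 4) ->
  \sum_(p <- s)
     normc (\sum_(k <- ss) expi ((a p * lambda ^ k)%:R / p%:R : R)) ^+ 2 <=
  16 * n%:R ^+ 2 * J%:R * (4 + S%:R / D%:R ^+ 2) * (size ss)%:R +
  16 * Y * n%:R * (S%:R + D%:R ^+ 2) * (size ss)%:R.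
Proof.
move=> us ltS D0 nJ L0 Y0 uss hs hY.
have LR : 0 < L%:R :> R by rewrite ltr0n.
have hs' p : p \in s -> prime p && (p <= n)%N.
  by move=> /hs /and4P[-> ->].
pose g1 d : R := if (D <= d)%N then n%:R / d%:R * farey_sum R ss d else 0.
pose g2 d : R := if (d < D)%N then d%:R * farey_sum R ss d else 0.
have g10 d : 0 <= g1 d.
  by rewrite /g1; case: ifP => // _; rewrite !mulr_ge0 ?invr_ge0 ?farey_sum_ge0.
have g20 d : 0 <= g2 d.
  by rewrite /g2; case: ifP => // _; rewrite !mulr_ge0 ?invr_ge0 ?farey_sum_ge0.
pose U (g : nat -> R) p := \sum_(d < n.+1 | (0 < d)%N && (d %| p.-1)%N) g d.
apply: le_trans (_ : \sum_(p <- s) (2 * U g1 p + 2 * Y * U g2 p) <= _).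
  rewrite big_seq [leRHS]big_seq; apply: ler_sum => p ps.
  have /and4P[pp pn cl ca] := hs p ps.
  have [t0 tp ot] := mord_spec pp cl.
  set t := mord lambda p in t0 tp ot.
  have p0 := prime_gt0 pp.
  have p1 : (0 < p.-1)%N by have := prime_gt1 pp; case: (p) => [|[]].
  have tn : (t <= n)%N by rewrite (leq_trans (dvdn_leq p1 tp)) // (leq_trans (leq_pred _)).
  have tR : 0 < t%:R :> R by rewrite ltr0n.
  set tau := (size (divisors t))%:R : R.
  have tau0 : 0 < tau.
    rewrite ltr0n -has_predT; apply/hasP; exists 1%N => //.
    by rewrite -dvdn_divisors ?dvd1n.
  have widen (P : pred nat) (g : nat -> R) : (forall d, 0 <= g d) ->
      \sum_(d < t.+1 | (d %| t)%N && P d) g d <=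
      \sum_(d < n.+1 | (0 < d)%N && (d %| p.-1)%N) g d.
    move=> gg0; rewrite (big_ord_widen_cond n.+1 (fun d => (d %| t)%N && P d) g) ?ltnS //.
    rewrite big_mkcond [leRHS]big_mkcond; apply: ler_sum => d _.
    case: ifP => [/andP[/andP[dt Pd] _]|_]; last by case: ifP.
    by rewrite (dvdn_gt0 t0 dt) (dvdn_trans dt tp).
  have hG b : normc (gauss_sum R lambda (a p) p t b) ^+ 2 <= Y * t%:R ^+ 2 / tau.
    have := gauss_sum_energy R b L p0 t0 ot ca.
    set g := normc _; have g0 : 0 <= g by apply: normc_ge0.
    move=> h4; rewrite -(@ler_sqr _ (g ^+ 2)) ?nnegrE ?sqr_ge0 //; last first.
      by rewrite !mulr_ge0 ?sqr_ge0 ?invr_ge0 // ltW.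
    rewrite -(ler_pM2r (_ : 0 < L%:R ^+ 4 * tau ^+ 2)); last by rewrite mulr_gt0 ?exprn_gt0.
    have -> : (Y * t%:R ^+ 2 / tau) ^+ 2 * (L%:R ^+ 4 * tau ^+ 2) =
       t%:R ^+ 3 * (Y ^+ 2 * t%:R * L%:R ^+ 4) by field; apply: lt0r_neq0.
    apply: le_trans (_ : t%:R ^+ 3 * (tau ^+ 2 * (p%:R * (energy lambda L p)%:R)) <= _).
      have -> : (g ^+ 2) ^+ 2 * (L%:R ^+ 4 * tau ^+ 2) = tau ^+ 2 * (L%:R * g) ^+ 4 by ring.
      rewrite [leRHS]mulrCA ler_wpM2l ?sqr_ge0 // mulrA; exact: h4.
    by rewrite ler_wpM2l ?exprn_ge0 // hY.
  apply: le_trans (orbit_sum_bound ss D p0 t0 ot ca hG) _.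
  apply: lerD.
    rewrite -mulrA ler_wpM2l // mulr_sumr.
    apply: le_trans (_ : \sum_(d < t.+1 | (d %| t)%N && (D <= d)%N) g1 d <= _).
      apply: ler_sum => d /andP[dt Dd]; rewrite /g1 Dd ler_wpM2r ?farey_sum_ge0 //.
      have dR : 0 < d%:R :> R by rewrite ltr0n (leq_trans D0).
      rewrite ler_pM ?invr_ge0 ?ler_nat // lef_pV2 ?posrE // ler_nat.
      exact: dvdn_leq.
    exact: widen.
  have -> : 2 * (tau * (Y * t%:R ^+ 2 / tau) / t%:R ^+ 2) = 2 * Y.
    by field; apply/andP; split; apply: lt0r_neq0.
  rewrite ler_wpM2l ?mulr_ge0 //.
  apply: le_trans (_ : \sum_(d < t.+1 | (d %| t)%N && (d < D)%N) g2 d <= _).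
    by apply: ler_sum => d /andP[dt dD]; rewrite /g2 dD.
  exact: (widen (fun d => d < D)%N).
rewrite big_split /= -!mulr_sumr.
have h1 := sum_primes_dvd_pred n.+1 uss hs' g10.
have h2 := sum_primes_dvd_pred n.+1 uss hs' g20.
rewrite -!/(U _ _) in h1 h2.
apply: lerD.
  apply: le_trans (_ : 2 * (n%:R ^+ 2 * (J%:R * (8 * (4 + S%:R / D%:R ^+ 2) * (size ss)%:R))) <= _); last first.
    by rewrite le_eqVlt; apply/orP; left; apply/eqP; ring.
  rewrite ler_wpM2l //; apply: le_trans h1 _.
  apply: le_trans (_ : n%:R ^+ 2 * (\sum_(d < D * 2 ^ J | (D <= d)%N) farey_sum R ss d / d%:R ^+ 2) <= _); last first.
    by rewrite ler_wpM2l ?sqr_ge0 // farey_sum_dyadic.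
  rewrite (big_ord_widen_cond (D * 2 ^ J) (fun d => 0 < d)%N (fun d => (n %/ d)%:R * g1 d)) //.
  rewrite mulr_sumr big_mkcond [leRHS]big_mkcond; apply: ler_sum => d _.
  rewrite /g1; case: (boolP (D <= d)%N) => Dd; last by rewrite mulr0; case: ifP.
  case: ifP => [/andP[d0 _]|_]; last first.
    by rewrite !mulr_ge0 ?farey_sum_ge0 // invr_ge0 sqr_ge0.
  have dR : 0 < d%:R :> R by rewrite ltr0n.
  have le : (n %/ d)%:R <= n%:R / d%:R :> R.
    by rewrite ler_pdivlMr // -natrM ler_nat leq_trunc_div.
  apply: le_trans (ler_wpM2r _ le) _; first by rewrite !mulr_ge0 ?invr_ge0 ?farey_sum_ge0.
  by rewrite le_eqVlt; apply/orP; left; apply/eqP; field; apply: lt0r_neq0.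
apply: le_trans (_ : 2 * Y * (n%:R * (8 * (S%:R + D%:R ^+ 2) * (size ss)%:R)) <= _); last first.
  by rewrite le_eqVlt; apply/orP; left; apply/eqP; ring.
rewrite ler_wpM2l ?mulr_ge0 //; apply: le_trans h2 _.
apply: le_trans (_ : n%:R * (\sum_(d < D.+1) farey_sum R ss d) <= _); last first.
  by rewrite ler_wpM2l // large_sieve.
apply: le_trans (_ : \sum_(d < n.+1 | (d < D)%N) n%:R * farey_sum R ss d <= _).
  rewrite big_mkcond [leRHS]big_mkcond; apply: ler_sum => d _.
  rewrite /g2; case: (boolP (d < D)%N) => dD; last by rewrite mulr0; case: ifP.
  case: ifP => d0; last by rewrite mulr_ge0 ?farey_sum_ge0.
  rewrite mulrA -natrM ler_wpM2r ?farey_sum_ge0 // ler_nat.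
  exact: leq_trunc_div.
rewrite mulr_sumr.
have F0 (d : nat) : 0 <= n%:R * farey_sum R ss d by rewrite mulr_ge0 ?farey_sum_ge0.
case: (leqP n.+1 D.+1) => nD.
  rewrite (big_ord_widen_cond D.+1 (fun d => d < D)%N (fun d => n%:R * farey_sum R ss d)) //.
  by rewrite big_mkcond; apply: ler_sum => d _; case: ifP.
rewrite [leRHS](big_ord_widen n.+1 (fun d => n%:R * farey_sum R ss d)); last exact: ltnW.
rewrite big_mkcond [leRHS]big_mkcond; apply: ler_sum => d _; case: ifP => // dD.
  by rewrite ltnS ltnW.
by case: ifP.
Qed.

(** * Exceptional primes *)

Lemma harmonic_le (R : realType) (n : nat) : (0 < n)%N ->
  \sum_(1 <= d < n.+1) d%:R^-1 <= 1 + ln n%:R :> R.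
Proof.
elim: n => // n IH _; case: (posnP n) => [->|n0].
  by rewrite big_nat1 ln1 invr1 addr0.
rewrite big_nat_recr //=; apply: le_trans (lerD (IH n0) (lexx _)) _.
have nR : 0 < n%:R :> R by rewrite ltr0n.
have mR : 0 < n.+1%:R :> R by rewrite ltr0n.
rewrite -addrA lerD2l -lerBrDl.
have h : ln (1 + - (n.+1%:R)^-1) <= - (n.+1%:R)^-1 :> R.
  by apply: le_ln1Dx; rewrite ltrN2 invf_lt1 // ltr1n ltnS.
have E : 1 + - (n.+1%:R)^-1 = n%:R / n.+1%:R :> R.
  by rewrite -natr1; field; rewrite natr1 lt0r_neq0.
rewrite E ln_div ?posrE // in h.
by rewrite -lerN2 opprB.
Qed.

Lemma half_le_ln2 (R : realType) : 1 / 2 <= ln 2 :> R.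
Proof.
have : ln (1 + - (1 / 2)) <= - (1 / 2) :> R by apply: le_ln1Dx; lra.
have -> : 1 + - (1 / 2) = 2^-1 :> R by lra.
by rewrite lnV ?posrE //; lra.
Qed.

Lemma truncn_ge_half (R : realType) (x : R) : 1 <= x -> x / 2 <= (Num.truncn x)%:R.
Proof.
move=> x1; have h := truncnS_gt x; rewrite -natr1 in h.
have : 1 <= (Num.truncn x)%:R :> R by rewrite ler1n truncn_gt0.
by lra.
Qed.

Lemma mem_primes_upto (R : realType) (X : R) (p : nat) : 0 <= X ->
  (p \in primes_upto X) = prime p && (p%:R <= X).
Proof.
move=> X0; rewrite mem_filter mem_iota add1n ltnS.
case: (boolP (prime p)) => //= pp; rewrite prime_gt0 //=.
by rewrite truncn_ge_nat.
Qed.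

(** Chebyshev's lower bound, with exp2_le_primes applied to the integer part of
    X / 2. *)
Lemma primepi_ge (R : realType) (X : R) : 4 <= X -> X / (8 * ln X) <= (primepi X)%:R.
Proof.
move=> X4; have X0 : 0 <= X by lra.
have lX : 0 < ln X by rewrite ln_gt0 //; lra.
set n := Num.truncn (X / 2).
have n1 : (0 < n)%N by rewrite truncn_gt0; lra.
have nX : (n + n)%:R <= X.
  have : n%:R <= X / 2 by rewrite truncn_le //; lra.
  by rewrite natrD; lra.
have Xn : X / 4 <= n%:R.
  by have := truncnS_gt (X / 2); rewrite -/n -[n.+1%:R]natr1; lra.
have := exp2_le_primes n1.
set k := size _ => hk.
have kpi : (k <= primepi X)%N.
  apply: uniq_leq_size; first by rewrite filter_uniq ?iota_uniq.
  move=> p; rewrite mem_filter mem_iota add1n ltnS => /and3P[pp p1 pn].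
  by rewrite mem_primes_upto // pp (le_trans _ nX) // ler_nat.
have ln2 := half_le_ln2 R.
have h : n%:R * ln 2 <= k%:R * ln X.
  rewrite !mulr_natl -!lnXn //; last by lra.
  have XX : 0 < X by lra.
  rewrite ler_ln ?posrE ?exprn_gt0 //.
  apply: le_trans (_ : ((n + n)%:R ^+ k) <= _).
    by rewrite -!natrX ler_nat.
  by rewrite lerXn2r ?nnegrE.
rewrite ler_pdivrMr; last by lra.
have kR : k%:R * ln X <= (primepi X)%:R * ln X by rewrite ler_wpM2r ?ler_nat // ltW.
by nra.
Qed.

Lemma count_markov (R : numDomainType) (T : Type) (s : seq T) (f : T -> R) (c : R)
    (Q : pred T) :
  (forall x, 0 <= f x) -> (forall x, Q x -> c <= f x) ->
  (count Q s)%:R * c <= \sum_(x <- s) f x.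
Proof.
move=> f0 hQ; rewrite mulr_natl.
have -> : c *+ count Q s = \sum_(x <- s | Q x) c by rewrite big_const_seq iter_addr_0.
rewrite [leRHS](bigID Q) /=; apply: le_trans (_ : \sum_(x <- s | Q x) f x <= _).
  exact: ler_sum.
by rewrite lerDl sumr_ge0.
Qed.

Definition orbit_sum (R : realType) (lambda : nat) (ss : seq nat) (p a : nat) : R[i] :=
  \sum_(k <- ss) expi ((a * lambda ^ k)%:R / p%:R : R).

Definition well_spread (R : realType) (lambda : nat) (ss : seq nat) (dl : R) (p : nat) :=
  forall a, coprime a p -> normc (orbit_sum R lambda ss p a) <= dl * (size ss)%:R.

(** Here X = W ^ 12, so that the powers X ^ (1 / 2), X ^ (1 / 3) and
    X ^ (- 1 / 12) that occur in the proof are powers of W. The hypothesis on S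
    keeps the contribution of the small denominators below the bound for the
    large ones. *)
Lemma count_bad_primes (R : realType) (lambda : nat) (ss : seq nat) (S : nat)
    (W dl : R) :
  (2 <= lambda)%N -> uniq ss -> all (fun k => k < S)%N ss -> (0 < size ss)%N ->
  (0 < S)%N -> 1 <= W -> 0 < dl -> 1 <= ln (W ^+ 12) ->
  160 * ln (W ^+ 12) ^+ 4 * S%:R <= W ^+ 13 ->
  (count (fun p => ~~ ((W ^+ 6 / ln (W ^+ 12) < p%:R) && `[< well_spread lambda ss dl p >]))
     (primes_upto (W ^+ 12)))%:R <=
  lambda%:R + (2 * lambda%:R + 5) * W ^+ 12 / ln (W ^+ 12) ^+ 2 +
  241 * W ^+ 24 * ln (W ^+ 12) / (dl ^+ 2 * (size ss)%:R).
Proof.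
move=> l2 us ltS ss0 S0 W1 dl0 le1 hS.
set X := W ^+ 12 in le1 hS *; set l := ln X in le1 hS *.
have W0 : 0 < W by lra.
have X1 : 1 <= X by rewrite exprn_ege1.
have X0 : 0 < X by lra.
have l0 : 0 < l by lra.
set N := (size ss)%:R : R; have N0 : 0 < N by rewrite ltr0n.
set s := primes_upto X; set n := Num.truncn X.
have nX : n%:R <= X by rewrite truncn_le // ltW.
have n0 : (0 < n)%N by rewrite truncn_gt0.
have us' : uniq s by rewrite filter_uniq ?iota_uniq.
have sp p : p \in s -> prime p && (p <= n)%N.
  by rewrite mem_filter mem_iota add1n ltnS => /and3P[-> _ ->].
have sizes : (size s <= n)%N by rewrite size_filter -[X in (_ <= X)%N](size_iota 1) count_size.
set T := Num.truncn (W ^+ 6 / l).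
have TR : T%:R <= W ^+ 6 / l by rewrite truncn_le // divr_ge0 ?exprn_ge0 ?ltW.
(* L is about X ^ (1 / 3), where the two terms L ^ 2 X and L ^ 5 of the total
   energy balance. *)
set L := Num.truncn (W ^+ 4).
have W41 : 1 <= W ^+ 4 by rewrite exprn_ege1.
have L0 : (0 < L)%N by rewrite truncn_gt0.
have LR : 0 < L%:R :> R by rewrite ltr0n.
have LW : L%:R <= W ^+ 4 by rewrite truncn_le // (le_trans _ W41).
have WL : W ^+ 4 / 2 <= L%:R by apply: truncn_ge_half.
(* A bad prime divides lambda (b1), or gives lambda a small order (b2), or has
   large energy (b3), or has a predecessor with many divisors (b4); or none of
   these holds and some orbit sum is large (b5). *)
pose b1 p := ~~ coprime lambda p.
pose b2 p := coprime lambda p && (mord lambda p <= T)%N.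
pose b3 p := L%:R ^+ 2 * l ^+ 2 <= (energy lambda L p)%:R :> R.
pose b4 p := l ^+ 3 <= (size (divisors p.-1))%:R :> R.
pose b5 p := [&& ~~ b1 p, ~~ b2 p, ~~ b3 p, ~~ b4 p & ~~ `[< well_spread lambda ss dl p >]].
have c1 : (count b1 s)%:R <= lambda%:R :> R.
  rewrite ler_nat -size_filter ltnW //; apply: leq_trans (ltn_expl _ (isT : (1 < 2)%N)) _.
  apply: leq_exp2_primes; first by rewrite filter_uniq.
    move=> p; rewrite mem_filter => /andP[h /sp/andP[pp _]]; rewrite pp /=.
    by move: h; rewrite /b1 coprime_sym prime_coprime // negbK.
  by apply: leq_trans l2.
have c2 : (count b2 s)%:R <= lambda%:R * X / l ^+ 2 :> R.
  apply: le_trans (_ : (lambda * T ^ 2)%N%:R <= _).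
    rewrite ler_nat -size_filter; apply: small_order_count => //.
      by rewrite filter_uniq.
    by move=> p; rewrite mem_filter => /andP[/andP[-> ->] /sp/andP[-> _]].
  rewrite natrM -mulrA ler_wpM2l // (natrX _ T 2).
  apply: le_trans (_ : (W ^+ 6 / l) ^+ 2 <= _).
    by rewrite ler_sqr ?nnegrE // divr_ge0 ?exprn_ge0 ?ltW.
  by rewrite expr_div_n -exprM.
have c3 : (count b3 s)%:R <= (lambda%:R + 3) * X / l ^+ 2 :> R.
  have h1 := count_markov (f := fun p => (energy lambda L p)%:R : R) s (fun=> ler0n _ _) (fun p (h : b3 p) => h).
  have h2 : \sum_(p <- s) (energy lambda L p)%:R <= (lambda%:R + 3) * X * L%:R ^+ 2 :> R.
    apply: le_trans (_ : (size s * (2 * L ^ 2) + L ^ 4 * (lambda * L + 1))%N%:R <= _).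
      rewrite -natr_sum ler_nat; apply: sum_energy_le => // p /sp /andP[] //.
    rewrite !(natrX, natrD, natrM).
    have a1 : (size s)%:R <= X by apply: le_trans nX; rewrite ler_nat.
    have a2 : L%:R ^+ 3 <= X.
      apply: le_trans (_ : (W ^+ 4) ^+ 3 <= _); last by rewrite -exprM.
      by rewrite lerXn2r ?nnegrE // exprn_ge0 // ltW.
    have a3 : 1 <= L%:R :> R by rewrite ler1n.
    have a4 : 0 <= lambda%:R :> R by [].
    have a5 : L%:R ^+ 4 * (lambda%:R * L%:R + 1) <= L%:R ^+ 2 * ((lambda%:R + 1) * X).
      apply: le_trans (_ : L%:R ^+ 2 * ((lambda%:R + 1) * L%:R ^+ 3) <= _).
        have -> : L%:R ^+ 4 * (lambda%:R * L%:R + 1) = L%:R ^+ 2 * (lambda%:R * L%:R ^+ 3 + L%:R ^+ 2) :> R by ring.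
        rewrite ler_wpM2l ?sqr_ge0 // mulrDl mul1r lerD2l.
        by rewrite ler_weXn2l.
      by rewrite !ler_wpM2l ?sqr_ge0 // addr_ge0.
    have a6 : (size s)%:R * (2 * L%:R ^+ 2) <= X * (2 * L%:R ^+ 2).
      by rewrite ler_wpM2r // mulr_ge0 ?sqr_ge0.
    by move: a5 a6; lra.
  rewrite ler_pdivlMr ?exprn_gt0 // -(ler_pM2r (_ : 0 < L%:R ^+ 2)) ?exprn_gt0 //.
  by rewrite -mulrA [X in _ * X]mulrC; apply: le_trans h1 h2.
have c4 : (count b4 s)%:R <= 2 * X / l ^+ 2 :> R.
  have h1 := count_markov (f := fun p => (size (divisors p.-1))%:R : R) s (fun=> ler0n _ _) (fun p (h : b4 p) => h).
  have h2 : \sum_(p <- s) (size (divisors p.-1))%:R <= 2 * X * l :> R.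
    rewrite -natr_sum; apply: le_trans (_ : (\sum_(1 <= d < n.+1) n %/ d)%N%:R <= _).
      by rewrite ler_nat; apply: sum_divisors_le.
    rewrite natr_sum; apply: le_trans (_ : \sum_(1 <= d < n.+1) n%:R * d%:R^-1 <= _).
      rewrite big_nat_cond [leRHS]big_nat_cond; apply: ler_sum => d /andP[/andP[d1 _] _].
      by rewrite ler_pdivlMr ?ltr0n // -natrM ler_nat leq_trunc_div.
    rewrite -mulr_sumr; apply: le_trans (ler_wpM2l _ (harmonic_le R n0)) _ => //.
    have h3 : ln n%:R <= l by rewrite ler_ln ?posrE // ltr0n.
    apply: le_trans (_ : n%:R * (2 * l) <= _); first by rewrite ler_wpM2l //; lra.
    by rewrite mulrCA -mulrA ler_wpM2l // ler_wpM2r // ltW.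
  rewrite ler_pdivlMr ?exprn_gt0 // -(ler_pM2r l0).
  by rewrite -mulrA -exprSr; apply: le_trans h1 h2.
have c5 : (count b5 s)%:R <= 241 * W ^+ 24 * l / (dl ^+ 2 * N) :> R.
  (* a p is a frequency whose orbit sum is large, when there is one. *)
  pose a p := if pselect (exists a, coprime a p /\ dl * N < normc (orbit_sum R lambda ss p a)) is left h
    then projT1 (cid h) else 1%N.
  pose s5 := [seq p <- s | b5 p].
  have hb p : p \in s5 -> [/\ coprime lambda p, (T < mord lambda p)%N,
       (energy lambda L p)%:R <= L%:R ^+ 2 * l ^+ 2 :> R & (size (divisors p.-1))%:R <= l ^+ 3 :> R].
    rewrite mem_filter => /andP[/and5P[]]; rewrite /b1 negbK /b2 => cl.
    by rewrite cl -ltnNge => h2 /negP h3 /negP h4 _ _; split => //;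
      apply: ltW; rewrite ltNge; apply/negP.
  have ha p : p \in s5 -> coprime (a p) p /\ dl * N < normc (orbit_sum R lambda ss p (a p)).
    rewrite mem_filter => /andP[/and5P[_ _ _ _ /asboolPn nw] _]; rewrite /a.
    case: pselect => [h|nh]; first by case: (cid h).
    exfalso; apply: nw => b cb; rewrite leNgt; apply/negP => h.
    by apply: nh; exists b.
  (* D ^ 2 is about S, the balance point of the large sieve. *)
  set D := (Num.truncn (Num.sqrt (S%:R : R))).+1.
  have SR : 1 <= S%:R :> R by rewrite ler1n.
  have q0 : 0 <= Num.sqrt (S%:R : R) by rewrite sqrtr_ge0.
  have q1 : 1 <= Num.sqrt (S%:R : R) by have := ler_wsqrtr SR; rewrite sqrtr1.
  have qq : Num.sqrt (S%:R : R) ^+ 2 = S%:R by rewrite sqr_sqrtr.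
  have SD : S%:R <= D%:R ^+ 2 :> R.
    rewrite -qq ler_sqr ?nnegrE //; apply: ltW; exact: truncnS_gt.
  have DS : D%:R ^+ 2 <= 4 * S%:R :> R.
    have : D%:R <= 2 * Num.sqrt (S%:R : R).
      rewrite /D -natr1; have : (Num.truncn (Num.sqrt (S%:R : R)))%:R <= Num.sqrt (S%:R : R) by rewrite truncn_le.
      by lra.
    have : 0 <= D%:R :> R by [].
    by move: qq; set q := Num.sqrt _; nra.
  set J := (trunc_log 2 n).+1.
  have nJ : (n < D * 2 ^ J)%N.
    by apply: leq_trans (trunc_log_ltn n (isT : (1 < 2)%N)) _; rewrite leq_pmull.
  have Jl : J%:R <= 3 * l.
    have ln2 := half_le_ln2 R.
    have : ln (2 ^+ trunc_log 2 n) <= l.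
      rewrite ler_ln ?posrE ?exprn_gt0 //; apply: le_trans nX.
      by rewrite -natrX ler_nat trunc_logP.
    have -> : J%:R = (trunc_log 2 n)%:R + 1 :> R by rewrite natr1.
    rewrite lnXn // -[ln 2 *+ _]mulr_natl.
    have : 0 <= (trunc_log 2 n)%:R :> R by [].
    set j := (trunc_log 2 n)%:R; nra.
  pose Y := 2 * l ^+ 5 / W.
  have Y0 : 0 <= Y by rewrite !mulr_ge0 ?invr_ge0 ?exprn_ge0 // ltW.
  have main := @sum_orbit_sqr_le R lambda n S D J L ss s5 a Y us ltS isT nJ L0 Y0.
  have lower : (size s5)%:R * (dl * N) ^+ 2 <=
     \sum_(p <- s5) normc (\sum_(k <- ss) expi ((a p * lambda ^ k)%:R / p%:R : R)) ^+ 2.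
    rewrite -(count_predT s5) mulr_natl.
    have -> : (dl * N) ^+ 2 *+ count predT s5 = \sum_(p <- s5) (dl * N) ^+ 2.
      by rewrite big_const_seq iter_addr_0.
    rewrite big_seq [leRHS]big_seq; apply: ler_sum => p /ha[_ /ltW h].
    by rewrite ler_sqr ?nnegrE ?normc_ge0 // mulr_ge0 // ltW.
  have upper : \sum_(p <- s5) normc (\sum_(k <- ss) expi ((a p * lambda ^ k)%:R / p%:R : R)) ^+ 2
     <= 241 * W ^+ 24 * l * N.
    apply: le_trans (main _ _ _) _.
    - by rewrite filter_uniq.
    - move=> p ps; have [ca _] := ha p ps; have [cl _ _ _] := hb p ps.
      by move: ps; rewrite mem_filter => /andP[_ /sp /andP[-> ->]]; rewrite cl ca.
    - move=> p ps; have [cl tT hE ht] := hb p ps.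
      have /sp/andP[pp pn] : p \in s by move: ps; rewrite mem_filter => /andP[].
      have [t0 tp _] := mord_spec pp cl.
      set t := mord lambda p in tT t0 tp *.
      have p1 : (0 < p.-1)%N by have := prime_gt1 pp; case: (p) => [|[]].
      have tR : W ^+ 6 / l <= t%:R.
        apply: ltW; apply: lt_le_trans (truncnS_gt _) _; by rewrite ler_nat.
      have tau : (size (divisors t))%:R <= l ^+ 3.
        apply: le_trans ht; rewrite ler_nat; apply: uniq_leq_size; first exact: divisors_uniq.
        move=> d; rewrite -!dvdn_divisors // => h; exact: dvdn_trans tp.
      have pX : p%:R <= X by apply: le_trans nX; rewrite ler_nat.
      apply: le_trans (_ : (l ^+ 3) ^+ 2 * (X * (L%:R ^+ 2 * l ^+ 2)) <= _).
        apply: ler_pM; rewrite ?sqr_ge0 ?mulr_ge0 //.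
          by rewrite ler_sqr ?nnegrE // exprn_ge0 // ltW.
        exact: ler_pM.
      apply: le_trans (_ : Y ^+ 2 * (W ^+ 6 / l) * (L%:R ^+ 2 * (W ^+ 4 / 2) ^+ 2) <= _).
        have -> : Y ^+ 2 * (W ^+ 6 / l) * (L%:R ^+ 2 * (W ^+ 4 / 2) ^+ 2) =
           l * ((l ^+ 3) ^+ 2 * (X * (L%:R ^+ 2 * l ^+ 2))).
          by rewrite /Y /X; field; apply/andP; split; apply: lt0r_neq0.
        rewrite -[leLHS]mul1r ler_wpM2r // !mulr_ge0 ?exprn_ge0 // ltW //.
      have w4 : 0 <= W ^+ 4 / 2 by rewrite divr_ge0 ?exprn_ge0 // ltW.
      have w6 : 0 <= W ^+ 6 / l by rewrite divr_ge0 ?exprn_ge0 // ltW.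
      have y6 : 0 <= Y ^+ 2 * (W ^+ 6 / l) by rewrite mulr_ge0 ?sqr_ge0.
      have l4 : 0 <= L%:R ^+ 2 * (W ^+ 4 / 2) ^+ 2 by rewrite mulr_ge0 ?sqr_ge0.
      apply: (ler_pM y6 l4); first by rewrite ler_wpM2l ?sqr_ge0.
      have -> : L%:R ^+ 4 = L%:R ^+ 2 * L%:R ^+ 2 :> R by rewrite -exprD.
      by rewrite ler_wpM2l ?sqr_ge0 // ler_sqr ?nnegrE.
    rewrite -/N.
    (* The large denominators give 240 and the small ones 1. *)
    have u1 : 16 * n%:R ^+ 2 * J%:R * (4 + S%:R / D%:R ^+ 2) <= 240 * W ^+ 24 * l.
      have DR : 0 < D%:R ^+ 2 :> R by rewrite exprn_gt0.
      have v1 : S%:R / D%:R ^+ 2 <= 1 :> R by rewrite ler_pdivrMr // mul1r.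
      have v0 : 0 <= S%:R / D%:R ^+ 2 :> R by rewrite divr_ge0 // ltW.
      have n2 : n%:R ^+ 2 <= W ^+ 24.
        apply: le_trans (_ : X ^+ 2 <= _); last by rewrite -exprM.
        by rewrite ler_sqr ?nnegrE // ltW.
      apply: le_trans (_ : 16 * W ^+ 24 * (3 * l) * 5 <= _); last by lra.
      have n16 : 0 <= 16 * n%:R ^+ 2 :> R by rewrite mulr_ge0 ?sqr_ge0.
      have nJ0 : 0 <= 16 * n%:R ^+ 2 * J%:R :> R by rewrite mulr_ge0.
      have v4 : 0 <= 4 + S%:R / D%:R ^+ 2 :> R by rewrite addr_ge0.
      apply: (ler_pM nJ0 v4); last by lra.
      by apply: (ler_pM n16) => //; rewrite ler_wpM2l.
    have u2 : 16 * Y * n%:R * (S%:R + D%:R ^+ 2) <= W ^+ 24 * l.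
      apply: le_trans (_ : 16 * Y * X * (5 * S%:R) <= _).
        have y0 : 0 <= 16 * Y by rewrite mulr_ge0.
        have yn : 0 <= 16 * Y * n%:R by rewrite mulr_ge0.
        have sd : 0 <= S%:R + D%:R ^+ 2 :> R by rewrite addr_ge0 ?sqr_ge0.
        by apply: (ler_pM yn sd); [rewrite ler_wpM2l | lra].
      have -> : 16 * Y * X * (5 * S%:R) = (160 * l ^+ 4 * S%:R) * (W ^+ 11 * l).
        by rewrite /Y /X; field; apply: lt0r_neq0.
      have -> : W ^+ 24 * l = W ^+ 13 * (W ^+ 11 * l) by ring.
      by rewrite ler_wpM2r // mulr_ge0 ?exprn_ge0 // ltW.
    rewrite -mulrDl (ler_wpM2r (ltW N0)) //.
    apply: le_trans (lerD u1 u2) _.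
    by rewrite le_eqVlt; apply/orP; left; apply/eqP; ring.
  rewrite -size_filter -/s5 ler_pdivlMr ?mulr_gt0 ?exprn_gt0 //.
  rewrite -(ler_pM2r N0); apply: le_trans (le_trans lower upper).
  by rewrite le_eqVlt; apply/orP; left; apply/eqP; ring.
apply: le_trans (_ : (count b1 s + count b2 s + count b3 s + count b4 s + count b5 s)%N%:R <= _).
  rewrite ler_nat.
  have addU (P Q : pred nat) : (count (predU P Q) s <= count P s + count Q s)%N.
    by rewrite -count_predUI leq_addr.
  apply: leq_trans (leq_add (leq_add (leq_add (addU b1 b2) (leqnn _)) (leqnn _)) (leqnn _)).
  apply: leq_trans (leq_add (leq_add (addU _ b3) (leqnn _)) (leqnn _)).
  apply: leq_trans (leq_add (addU _ b4) (leqnn _)).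
  apply: leq_trans (addU _ b5).
  rewrite -!size_filter; apply: uniq_leq_size; first by rewrite filter_uniq.
  move=> p; rewrite mem_filter => /andP[bad ps]; rewrite mem_filter ps andbT /=.
  apply/negPn/negP; rewrite !negb_or => /andP[/andP[/andP[/andP[n1 n2] n3] n4] n5].
  move/negP: n5; apply; rewrite /b5 n1 n2 n3 n4 /=.
  move: bad; apply: contra => ->; rewrite andbT.
  move: n1 n2; rewrite /b1 negbK /b2 => cl; rewrite cl -ltnNge => tT.
  have /andP[pp pn] := sp p ps.
  have [t0 tp _] := mord_spec pp cl.
  have p1 : (0 < p.-1)%N by have := prime_gt1 pp; case: (p) => [|[]].
  apply: lt_le_trans (truncnS_gt _) _; rewrite ler_nat -/T.
  by apply: leq_trans tT (leq_trans (dvdn_leq p1 tp) (leq_pred _)).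
rewrite !natrD.
apply: le_trans (lerD (lerD (lerD (lerD c1 c2) c3) c4) c5) _.
by rewrite le_eqVlt; apply/orP; left; apply/eqP; field; rewrite !lt0r_neq0.
Qed.

(** * From exponential sums to discrepancy *)

Lemma card_interval_le (R : realType) (n : nat) (u v : R) : u <= v ->
  #|[pred i : 'I_n | u < i%:R < v]|%:R <= v - u + 1.
Proof.
move=> uv; pose Q i := (i < n)%N && (u < i%:R < v).
have [|no] := pselect (exists i, Q i); last first.
  rewrite eq_card0; first by lra.
  by move=> i; rewrite inE /=; apply/negbTE/negP => h; apply: no; exists i; rewrite /Q ltn_ord.
case/ex_minnP => i0 /andP[_ /andP[ui0 i0v]] imin.
have h0 : 0 <= v - i0%:R by rewrite subr_ge0 ltW.
apply: le_trans (_ : (Num.truncn (v - i0%:R)).+1%:R <= _).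
  rewrite ler_nat -[X in (_ <= X)%N](size_iota i0).
  rewrite -(size_image (fun i : 'I_n => (i : nat)) [pred i : 'I_n | u < i%:R < v]).
  apply: uniq_leq_size.
    by rewrite map_inj_uniq ?enum_uniq //; apply: val_inj.
  move=> _ /mapP[i + ->]; rewrite mem_enum => ic.
  have ci : u < i%:R < v := ic.
  have ii : (i0 <= i)%N by apply: imin; rewrite /Q ltn_ord.
  rewrite mem_iota ii andTb addnS ltnS -leq_subLR.
  have : (i - i0)%:R <= v - i0%:R by rewrite natrB // lerD2r; case/andP: ci => _ /ltW.
  by rewrite -truncn_ge_nat.
rewrite -natr1 lerD2r; apply: le_trans (_ : v - i0%:R <= _); last by lra.
by rewrite truncn_le.
Qed.

Definition fejer (R : realType) (K : nat) (x : R) : R := normc (dirichlet K x) ^+ 2 / K%:R.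

Lemma fejer_ge0 (R : realType) (K : nat) (x : R) : 0 <= fejer K x.
Proof. by rewrite mulr_ge0 ?sqr_ge0 // invr_ge0. Qed.

Lemma fejerDint (R : realType) (K : nat) (x : R) (m : int) :
  fejer K (x + m%:~R) = fejer K x.
Proof. by rewrite /fejer dirichletDint. Qed.

Lemma fejer_far (R : realType) (K : nat) (x eta : R) :
  (0 < K)%N -> 0 < eta -> eta <= `|x| <= 1 / 2 -> fejer K x <= (K%:R * eta ^+ 2)^-1.
Proof.
move=> K0 e0 /andP[ex /(normc_dirichlet_mul K) h].
rewrite /fejer invfM mulrC ler_wpM2l ?invr_ge0 //.
rewrite -exprVn ler_sqr ?nnegrE ?normc_ge0 //; last by rewrite invr_ge0 ltW.
rewrite -[leRHS]mul1r ler_pdivlMr //; apply: le_trans h.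
by rewrite ler_wpM2l ?normc_ge0.
Qed.

Lemma sqr_normc_dirichlet (R : realType) (K : nat) (x : R) :
  ((normc (dirichlet K x) ^+ 2)%:C)%C =
  \sum_(i < K) \sum_(j < K) expi ((i%:R - j%:R) * x).
Proof.
rewrite /dirichlet normc_sqr_sum; apply: eq_bigr => i _; apply: eq_bigr => j _.
by rewrite conjc_expi -expiD mulrBl.
Qed.

(** The mean over K equally spaced points is exact for trigonometric
    polynomials of degree less than K, and the Fejer kernel has mean 1. *)
Lemma sum_fejer_grid (R : realType) (K : nat) (x : R) : (0 < K)%N ->
  \sum_(j < K) fejer K (x - j%:R / K%:R) = K%:R.
Proof.
move=> K0; have KR : K%:R != 0 :> R by rewrite pnatr_eq0 -lt0n.
rewrite -mulr_suml; apply: (canLR (mulfK KR)).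
apply: complexI; rewrite rmorph_sum /=.
under eq_bigr do rewrite sqr_normc_dirichlet.
rewrite exchange_big /=.
under eq_bigr do rewrite exchange_big /=.
transitivity (\sum_(i < K) \sum_(i' < K) (if i == i' then K%:R else 0 : R[i])).
  apply: eq_bigr => i _; apply: eq_bigr => i' _.
  transitivity (expi ((i%:R - i'%:R) * x) *
     dirichlet K ((i'%:Z - i%:Z)%:~R / K%:R : R)).
    rewrite mulr_sumr; apply: eq_bigr => j _; rewrite -expiD; congr expi.
    by rewrite intrB -!pmulrn; field.
  rewrite sumr_dirichlet // -eqz_mod_dvd !modz_nat eqz_nat !modn_small // eq_sym val_eqE.
  case: eqP => [->|_]; last by rewrite mulr0.
  by rewrite subrr mul0r expi0 mul1r.
under eq_bigr => i _.
  rewrite (bigD1 i) //= eqxx big1 ?addr0; last by move=> j /negbTE; rewrite eq_sym => ->.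
  over.
by rewrite sumr_const card_ord rmorphM /= !rmorph_nat -[LHS]mulr_natl.
Qed.

(** Frequency 0 contributes the number of points, and each of the other
    coefficients of the kernel is at most 1. *)
Lemma sum_fejer_points (R : realType) (K : nat) (xs : seq R) (c dl : R) :
  (0 < K)%N ->
  (forall h, (0 < h < K)%N ->
     normc (\sum_(x <- xs) expi (h%:R * x)) <= dl * (size xs)%:R) ->
  0 <= dl ->
  \sum_(x <- xs) fejer K (x - c) <= (1 + K%:R * dl) * (size xs)%:R.
Proof.
move=> K0 hs dl0; set N := (size xs)%:R : R.
have KR : 0 < K%:R :> R by rewrite ltr0n.
rewrite -mulr_suml ler_pdivrMr //.
set T := \sum_(x <- xs) _.
have T0 : 0 <= T by apply: sumr_ge0 => x _; apply: sqr_ge0.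
have : (T%:C)%C = \sum_(i < K) \sum_(j < K) expi ((i%:R - j%:R) * - c) *
    \sum_(x <- xs) expi ((i%:R - j%:R) * x).
  rewrite rmorph_sum /=; under eq_bigr do rewrite sqr_normc_dirichlet.
  rewrite exchange_big /=; apply: eq_bigr => i _.
  rewrite exchange_big /=; apply: eq_bigr => j _.
  by rewrite mulr_sumr; apply: eq_bigr => x _; rewrite -expiD; congr expi; ring.
move=> /(congr1 (@normc R)); rewrite normc_real ger0_norm // => ->.
apply: le_trans (_ : \sum_(i < K) \sum_(j < K) ((if i == j then N else 0) + dl * N) <= _).
  apply: le_trans (normc_sum _ _ _) _; apply: ler_sum => i _.
  apply: le_trans (normc_sum _ _ _) _; apply: ler_sum => j _.
  rewrite normcM normc_expi mul1r.
  case: eqP => [->|/eqP ij].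
    apply: le_trans (normc_sum _ _ _) _.
    under eq_bigr do rewrite normc_expi.
    by rewrite big_const_seq count_predT iter_addr_0 lerDl mulr_ge0.
  rewrite add0r; move: ij; rewrite neq_ltn => /orP[] ij.
    have -> : normc (\sum_(x <- xs) expi ((i%:R - j%:R) * x)) =
       normc (\sum_(x <- xs) expi ((j - i)%:R * x)).
      rewrite -[RHS]normc_conj (raddf_sum (@conjc R)); congr normc.
      by apply: eq_bigr => x _; rewrite natrB ?(ltnW ij) // -[RHS]/(conjc (expi _)) conjc_expi -mulNr opprB.
    by apply: hs; rewrite subn_gt0 ij (leq_ltn_trans (leq_subr _ _)).
  have -> : normc (\sum_(x <- xs) expi ((i%:R - j%:R) * x)) =
     normc (\sum_(x <- xs) expi ((i - j)%:R * x)) by rewrite natrB // ltnW.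
  by apply: hs; rewrite subn_gt0 ij (leq_ltn_trans (leq_subr _ _)).
under eq_bigr => i _.
  rewrite big_split /= (bigD1 i) //= eqxx big1 ?addr0; last by move=> j /negbTE; rewrite eq_sym => ->.
  rewrite sumr_const card_ord -[(dl * N) *+ K]mulr_natl; over.
rewrite sumr_const card_ord -[leLHS]mulr_natl.
by rewrite le_eqVlt; apply/orP; left; apply/eqP; ring.
Qed.

(** For x in [a, b), the Fejer mass carried by the grid points i / K - 1 within
    eta of [a, b) is nearly the total mass K. The three periods i < 3 K make it
    possible to treat arcs that wrap around 0 without distinguishing cases. *)
Lemma fejer_mass_ge (R : realType) (K : nat) (a b x eta : R) :
  (0 < K)%N -> 0 < eta -> 0 <= a -> b <= 1 -> a <= x < b ->
  K%:R - (eta ^+ 2)^-1 <=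
  \sum_(i < 3 * K | a - eta < i%:R / K%:R - 1 < b + eta) fejer K (x - (i%:R / K%:R - 1)).
Proof.
move=> K0 e0 a0 b1 /andP[ax xb].
have KR : 0 < K%:R :> R by rewrite ltr0n.
have KR0 : K%:R != 0 :> R by apply: lt0r_neq0.
have [m hm] := choice (fun j : 'I_K => nearest_int (x - j%:R / K%:R)).
pose u (j : 'I_K) := x - j%:R / K%:R - (m j)%:~R.
have jK (j : 'I_K) : 0 <= (j%:R / K%:R : R) < 1.
  by rewrite divr_ge0 //= ltr_pdivrMr // mul1r ltr_nat.
have mb j : (-1 <= m j <= 1)%R.
  have := hm j; rewrite ler_norml => /andP[h1 h2]; have /andP[h3 h4] := jK j.
  have h5 : ((-2)%:~R : R) < (m j)%:~R by rewrite mulrNz; lra.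
  have h6 : (m j)%:~R < (2%:~R : R) by lra.
  move: h5 h6; rewrite !ltr_int; move: (m j) => z; clear; lia.
pose i0 (j : 'I_K) := (j + absz (m j + 1)%R * K)%N.
(* i0 j is the representative of j on the grid of three periods that lies
   nearest to x. *)
have i0R j : (i0 j)%:R / K%:R - 1 = j%:R / K%:R + (m j)%:~R :> R.
  rewrite /i0 natrD natrM mulrDl mulfK // -addrA; congr (_ + _).
  by rewrite natr_absz ger0_norm ?intrD ?addrK //; have := mb j; move: (m j) => z; clear; lia.
have i0lt j : (i0 j < 3 * K)%N.
  have : (absz (m j + 1)%R <= 2)%N.
    by have := mb j; move: (m j) => z; clear; lia.
  by have := ltn_ord j; rewrite /i0; move: (absz _) => z h1 h2; clear -h1 h2; nia.
have i0inj : injective i0.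
  move=> j j' E; apply: val_inj => /=.
  have := congr1 (fun z => z %% K)%N E.
  by rewrite /i0 ![(_ + _ * K)%N]addnC !modnMDl !modn_small.
pose g i := if a - eta < i%:R / K%:R - 1 < b + eta then fejer K (x - (i%:R / K%:R - 1)) else 0.
have g0 i : 0 <= g i by rewrite /g; case: ifP => _ //; apply: fejer_ge0.
rewrite big_mkcond -/(\sum_(i < 3 * K) g i).
have gi0 (j : 'I_K) : `|u j| < eta -> g (i0 j) = fejer K (x - j%:R / K%:R).
  rewrite ltr_norml => /andP[h1 h2]; rewrite /g i0R.
  rewrite ifT; last by rewrite /u in h1 h2; apply/andP; split; lra.
  rewrite -[RHS](fejerDint _ _ (- m j)) mulrNz; congr fejer; ring.
rewrite lerBlDr -[leLHS](sum_fejer_grid x K0).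
rewrite (bigID (fun j : 'I_K => `|u j| < eta)) /=; apply: lerD.
  under eq_bigr do rewrite -gi0 //.
  apply: le_trans (_ : \sum_(j < K) g (i0 j) <= _).
    by rewrite [leRHS](bigID (fun j : 'I_K => `|u j| < eta)) /= lerDl sumr_ge0.
  have -> : \sum_(j < K) g (i0 j) = \sum_(i <- [seq i0 j | j <- enum 'I_K]) g i.
    by rewrite big_map big_enum.
  apply: ler_sum_uniq => //; first by rewrite map_inj_uniq ?enum_uniq.
  by apply/allP => _ /mapP[j _ ->].
apply: le_trans (_ : \sum_(j < K) (K%:R * eta ^+ 2)^-1 <= _).
  rewrite big_mkcond; apply: ler_sum => j _; case: ifP => h; last first.
    by rewrite invr_ge0 mulr_ge0 ?sqr_ge0.
  rewrite -(fejerDint _ _ (- m j)) mulrNz; apply: fejer_far => //.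
  by rewrite leNgt h hm.
by rewrite sumr_const card_ord -[leLHS]mulr_natl invfM mulVKf.
Qed.

(** Sum fejer_mass_ge over the points of the arc, then extend the sum to all
    points and apply sum_fejer_points at each of the roughly K (b - a + 2 eta)
    grid points. *)
Lemma count_arc_le (R : realType) (K : nat) (xs : seq R) (a b eta dl : R) :
  (0 < K)%N -> 0 < eta <= 1 / 2 -> 0 <= dl -> 0 <= a -> a <= b -> b <= 1 ->
  (forall h, (0 < h < K)%N ->
     normc (\sum_(x <- xs) expi (h%:R * x)) <= dl * (size xs)%:R) ->
  (count (fun x => a <= x < b) xs)%:R <=
  (b - a + (2 * eta + K%:R^-1 + 3 * (K%:R * dl) + (K%:R * eta ^+ 2)^-1)) * (size xs)%:R.
Proof.
move=> K0 /andP[e0 e2] dl0 a0 ab b1 hs.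
have KR : 0 < K%:R :> R by rewrite ltr0n.
have K1 : K%:R^-1 <= 1 :> R by rewrite invf_le1 // ler1n.
set N := (size xs)%:R : R; have N0 : 0 <= N by [].
set A := (count _ xs)%:R : R.
have AN : A <= N by rewrite ler_nat count_size.
pose J (i : 'I_(3 * K)) := a - eta < i%:R / K%:R - 1 < b + eta.
have Jcard : #|J|%:R <= K%:R * (b - a + 2 * eta) + 1.
  have -> : #|J| = #|[pred i : 'I_(3 * K) | K%:R * (a - eta + 1) < i%:R < K%:R * (b + eta + 1)]|.
    apply: eq_card => i; rewrite unfold_in inE /= /J.
    rewrite ltrBrDr ltrBlDr ltr_pdivlMr // ltr_pdivrMr //.
    by rewrite ![_ * K%:R]mulrC.
  apply: le_trans (card_interval_le _ _) _; last by lra.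
  by rewrite ler_pM2l //; lra.
have main : A * (K%:R - (eta ^+ 2)^-1) <= #|J|%:R * ((1 + K%:R * dl) * N).
  apply: le_trans (_ : \sum_(x <- xs | a <= x < b) \sum_(i | J i) fejer K (x - (i%:R / K%:R - 1)) <= _).
    have -> : A * (K%:R - (eta ^+ 2)^-1) = \sum_(x <- xs | a <= x < b) (K%:R - (eta ^+ 2)^-1).
      by rewrite big_const_seq iter_addr_0 -[RHS]mulr_natl.
    by apply: ler_sum => x hx; apply: fejer_mass_ge.
  rewrite exchange_big /=.
  have -> : #|J|%:R * ((1 + K%:R * dl) * N) = \sum_(i | J i) (1 + K%:R * dl) * N.
    by rewrite sumr_const -[RHS]mulr_natl.
  apply: ler_sum => i _; apply: le_trans (sum_fejer_points (i%:R / K%:R - 1) K0 hs dl0).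
  rewrite [leRHS](bigID (fun x => a <= x < b)) /= lerDl.
  by apply: sumr_ge0 => x _; apply: fejer_ge0.
set q := (eta ^+ 2)^-1 in main *.
have q0 : 0 <= q by rewrite invr_ge0 sqr_ge0.
rewrite invfM -/q.
have c0 : 0 <= (1 + K%:R * dl) * N by rewrite mulr_ge0 // addr_ge0 // mulr_ge0 // ltW.
have h2 : A * (K%:R - q) <= (K%:R * (b - a + 2 * eta) + 1) * ((1 + K%:R * dl) * N).
  by apply: le_trans main _; rewrite ler_wpM2r.
rewrite -(ler_pM2l KR).
set k := K%:R in KR K1 h2 *; set y := k * dl in h2 *.
have y0 : 0 <= y by rewrite mulr_ge0 // ltW.
have kk : k * k^-1 = 1 by rewrite divff // lt0r_neq0.
have -> : k * ((b - a + (2 * eta + k^-1 + 3 * y + k^-1 * q)) * N) =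
  (k * (b - a + 2 * eta) + 1 + 3 * k * y + q) * N.
  by field; apply: lt0r_neq0.
have Aq : A * q <= N * q by rewrite ler_wpM2r.
have w3 : (k * (b - a + 2 * eta) + 1) * y <= 3 * k * y.
  rewrite ler_wpM2r //; have : 1 <= k by rewrite ler1n.
  by nra.
have w4 : (k * (b - a + 2 * eta) + 1) * y * N <= 3 * k * y * N by rewrite ler_wpM2r.
by lra.
Qed.

(** An arc contains few points by count_arc_le, and many because its complement
    in [0, 1) consists of two arcs that contain few. *)
Lemma discrepancy_le (R : realType) (K : nat) (xs : seq R) (eta dl : R) :
  (0 < K)%N -> 0 < eta <= 1 / 2 -> 0 <= dl -> (0 < size xs)%N ->
  {in xs, forall x, 0 <= x < 1} ->
  (forall h, (0 < h < K)%N ->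
     normc (\sum_(x <- xs) expi (h%:R * x)) <= dl * (size xs)%:R) ->
  discrepancy xs <=
  2 * (2 * eta + K%:R^-1 + 3 * (K%:R * dl) + (K%:R * eta ^+ 2)^-1).
Proof.
move=> K0 he dl0 s0 hx hs.
set E := _ + (K%:R * eta ^+ 2)^-1.
have NR : 0 < (size xs)%:R :> R by rewrite ltr0n.
have up a b : 0 <= a -> a <= b -> b <= 1 ->
    (count (fun x => a <= x < b) xs)%:R <= (b - a + E) * (size xs)%:R.
  by move=> a0 ab b1; apply: count_arc_le.
have E0 : 0 <= E.
  have KR : 0 < K%:R :> R by rewrite ltr0n.
  have [e0 _] := andP he.
  have e1 := ltW e0.
  by rewrite /E !addr_ge0 // ?invr_ge0 ?mulr_ge0 ?sqr_ge0.
apply: ge_sup.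
  exists 0, 0, 0; split => //.
  rewrite (eq_count (a2 := pred0)) ?count_pred0 ?mul0r ?subrr ?normr0 //.
  by move=> x; apply/negbTE/negP => /andP[h1 h2]; have := le_lt_trans h1 h2; rewrite ltxx.
move=> _ [a [b [a0 ab b1 ->]]].
set A := (count _ xs)%:R : R.
have h1 := up a b a0 ab b1; rewrite -/A in h1.
have h2 := up 0 a (lexx _) a0 (le_trans ab b1).
have h3 := up b 1 (le_trans a0 ab) b1 (lexx _).
have split3 : (size xs)%:R = (count (fun x => 0 <= x < a) xs)%:R + A +
    (count (fun x => b <= x < 1) xs)%:R :> R.
  rewrite /A -!natrD -sum1_size -!sum1_count; congr _%:R.
  rewrite [in RHS]big_mkcond [X in (_ + X + _)%N]big_mkcond [X in (_ + _ + X)%N]big_mkcond /=.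
  rewrite -!big_split /= big_seq [RHS]big_seq; apply: eq_bigr => x xin.
  have /andP[x0 x1] := hx x xin; rewrite x0 x1 andbT /=.
  have [xa|ax] := ltP x a.
    by have xb := lt_le_trans xa ab; rewrite leNgt xb.
  by have [xb|bx] := ltP x b.
rewrite ler_norml -(ler_pM2r NR) -[in X in _ && X](ler_pM2r NR).
rewrite !mulrBl divfK ?lt0r_neq0 //.
by apply/andP; split; lra.
Qed.

(** * Choice of the parameters *)

Lemma powRD_gt0 (R : realType) (x a b : R) : 0 < x ->
  x `^ (a + b) = x `^ a * x `^ b.
Proof. by move=> x0; apply: powRD; rewrite (gt_eqF x0) implybT. Qed.

Lemma powR_ge1 (R : realType) (x a : R) : 1 <= x -> 0 <= a -> 1 <= x `^ a.
Proof. by move=> x1 a0; have := ler_powR x1 a0; rewrite powRr0. Qed.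

(** The logarithm is bounded by any small power of X, as ln X = ln (X ^ c') / c'
    is less than X ^ c' / c'. *)
Lemma ln_powR_le (R : realType) (A k c : R) : 0 <= A -> 0 <= k -> 0 < c ->
  \forall X \near +oo, A * ln X `^ k <= X `^ c.
Proof.
move=> A0 k0 c0; pose c' := c / (2 * (k + 1)).
have c'0 : 0 < c' by rewrite divr_gt0 // mulr_gt0 //; lra.
pose B := A * c'^-1 `^ k.
have B0 : 0 <= B by rewrite mulr_ge0 // powR_ge0.
near=> X.
have X1 : 1 <= X by near: X; apply: nbhs_pinfty_ge; exact: num_real.
have XB : B `^ (2 / c) <= X by near: X; apply: nbhs_pinfty_ge; exact: num_real.
have X0 : 0 < X by lra.
have l0 : 0 <= ln X by apply: ln_ge0.
have h1 : ln X <= X `^ c' * c'^-1.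
  rewrite ler_pdivlMr // mulrC -ln_powR ltW // ln_sublinear // powR_gt0 //.
have h2 : ln X `^ k <= X `^ (c / 2) * c'^-1 `^ k.
  apply: le_trans (_ : (X `^ c' * c'^-1) `^ k <= _).
    by rewrite ge0_ler_powR // nnegrE // mulr_ge0 ?powR_ge0 // invr_ge0 ltW.
  have c'V : 0 <= c'^-1 by rewrite invr_ge0 ltW.
  rewrite powRM ?powR_ge0 // ler_wpM2r ?powR_ge0 //.
  rewrite -powRrM ler_powR // /c'.
  have -> : c / (2 * (k + 1)) * k = c / 2 * (k / (k + 1)) by field; lra.
  have k1 : k / (k + 1) <= 1 by rewrite ler_pdivrMr; lra.
  by have : 0 <= c / 2; [lra | nra].
apply: le_trans (_ : X `^ (c / 2) * B <= _).
  by rewrite /B mulrCA ler_wpM2l.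
have -> : X `^ c = X `^ (c / 2) * X `^ (c / 2).
  by rewrite -powRD_gt0 //; congr (_ `^ _); field.
rewrite ler_wpM2l ?powR_ge0 //.
have -> : B = (B `^ (2 / c)) `^ (c / 2).
  rewrite -powRrM (_ : 2 / c * (c / 2) = 1) ?powRr1 //.
  by field; apply: lt0r_neq0.
by rewrite ge0_ler_powR ?nnegrE ?powR_ge0 ?divr_ge0 // ltW.
Unshelve. all: by end_near. Qed.

Lemma ln_ge_near (R : realType) (B : R) : \forall X \near +oo, B <= ln X.
Proof.
near=> X.
have h : expR B <= X by near: X; apply: nbhs_pinfty_ge; exact: num_real.
by rewrite -[B]expRK ler_ln ?posrE ?expR_gt0 // (lt_le_trans (expR_gt0 B)).
Unshelve. all: by end_near. Qed.

Lemma fracpart_itv (R : realType) (x : R) : 0 <= fracpart x < 1.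
Proof.
rewrite /fracpart; have /andP[h1 h2] := floor_itv x.
by rewrite intrD in h2; apply/andP; split; lra.
Qed.

Lemma sum_expi_residues (R : realType) (lambda N p h : nat) (s : nat -> nat) :
  \sum_(x <- power_residues R lambda s N p) expi (h%:R * x) =
  orbit_sum R lambda [seq s n | n <- iota 1 N] p h.
Proof.
rewrite /power_residues /orbit_sum !big_map; apply: eq_bigr => n _.
rewrite /fracpart; set m := Num.floor _.
rewrite mulrBr mulrA -natrM -[h%:R * m%:~R](_ : (h%:Z * m)%:~R = _); last by rewrite intrM.
by rewrite -mulrNz expiDint.
Qed.

(** With K close to r ^- 3, eta = r and dl = r ^ 4, each of the four error terms
    of discrepancy_le is O(r). All frequencies below K are prime to p as soon
    as K <= p. *)
Lemma well_spread_discrepancy (R : realType) (lambda N p : nat) (s : nat -> nat) (r : R) :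
  (0 < N)%N -> prime p -> 0 < r <= 1 / 2 -> 2 * r ^- 3 <= p%:R ->
  well_spread lambda [seq s n | n <- iota 1 N] (r ^+ 4) p ->
  discrepancy (power_residues R lambda s N p) <= 20 * r.
Proof.
move=> N0 pp /andP[r0 r2] rp ws.
set K := (Num.truncn (r ^- 3)).+1.
have r30 : 0 < r ^- 3 by rewrite invr_gt0 exprn_gt0.
have r31 : 1 <= r ^- 3.
  rewrite invf_ge1 ?exprn_gt0 // exprn_ile1 //; lra.
have Kge : r ^- 3 <= K%:R by rewrite ltW // truncnS_gt.
have Kle : K%:R <= 2 * r ^- 3.
  rewrite /K -[(_.+1)%:R]natr1.
  have : (Num.truncn (r ^- 3))%:R <= r ^- 3 by rewrite truncn_le ltW.
  by lra.
have KR : 0 < K%:R :> R by rewrite ltr0n.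
have sz : size (power_residues R lambda s N p) = N by rewrite size_map size_iota.
have h1 := @discrepancy_le R K (power_residues R lambda s N p) r (r ^+ 4).
apply: le_trans (h1 _ _ _ _ _ _) _ => //.
- by rewrite r0.
- by rewrite exprn_ge0 // ltW.
- by rewrite sz.
- by move=> _ /mapP[n _ ->]; apply: fracpart_itv.
- move=> h /andP[h0 hK]; rewrite sum_expi_residues.
  have -> : size (power_residues R lambda s N p) = size [seq s n | n <- iota 1 N].
    by rewrite !size_map.
  apply: ws; rewrite coprime_sym prime_coprime //.
  apply/negP => /(dvdn_leq h0); rewrite leqNgt => /negP; apply.
  apply: leq_trans hK _; rewrite -(ler_nat R); exact: le_trans Kle rp.
have e1 : K%:R * r ^+ 4 <= 2 * r.
  apply: le_trans (_ : 2 * r ^- 3 * r ^+ 4 <= _); first by rewrite ler_wpM2r // exprn_ge0 // ltW.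
  by rewrite le_eqVlt; apply/orP; left; apply/eqP; field; apply: lt0r_neq0.
have e2 : K%:R^-1 <= r.
  apply: le_trans (_ : r ^+ 3 <= _).
    by rewrite -[r ^+ 3]invrK lef_pV2 ?posrE.
  by rewrite -[leRHS]expr1 ler_wiXn2l //; lra.
have e3 : (K%:R * r ^+ 2)^-1 <= r.
  apply: le_trans (_ : (r ^- 3 * r ^+ 2)^-1 <= _).
    rewrite lef_pV2 ?posrE ?mulr_gt0 ?exprn_gt0 //.
    by rewrite ler_wpM2r // exprn_ge0 // ltW.
  by rewrite le_eqVlt; apply/orP; left; apply/eqP; field; apply: lt0r_neq0.
by lra.
Qed.

(** This is where the exponent 15 / 14 enters: it is less than 13 / 12, which
    leaves room for small powers of X. *)
Lemma exponent_budget (R : realType) (X l c1 c2 nuN : R) (N S : nat) :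
  1 <= X -> 0 <= l -> 0 < c1 ->
  (1 + c1) * (15%:R / 14%:R + c1) + c2 <= 13%:R / 12%:R ->
  320 * l `^ 4%:R <= X `^ c2 -> (0 < N)%N -> N%:R <= X * X `^ c1 ->
  nuN <= c1 -> (0 < S)%N -> S%:R <= N%:R `^ (15%:R / 14%:R + nuN) ->
  160 * l ^+ 4 * S.+1%:R <= X `^ (13%:R / 12%:R).
Proof.
move=> X1 l0 c10 c12 a2 N0 NX nc S0 SN.
have X0 : 0 < X by exact: lt_le_trans X1.
rewrite -(powR_mulrn 4) //; set z := l `^ 4%:R in a2 *.
have z0 : 0 <= z by apply: powR_ge0.
set y := X `^ ((1 + c1) * (15%:R / 14%:R + c1)).
have y0 : 0 <= y by apply: powR_ge0.
have Sy : S%:R <= y.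
  apply: le_trans SN _.
  apply: le_trans (_ : N%:R `^ (15%:R / 14%:R + c1) <= _).
    by rewrite ler_powR ?ler1n // lerD2l.
  rewrite /y powRrM ge0_ler_powR ?nnegrE ?powR_ge0 //; first by clear -c10; lra.
  by rewrite powRD_gt0 // powRr1 // ltW.
have S2 : S.+1%:R <= 2 * y.
  have : 1 <= S%:R :> R by rewrite ler1n.
  by rewrite -[S.+1%:R]natr1; clear -Sy; lra.
apply: le_trans (_ : 320 * z * y <= _).
  by have := ler_wpM2l z0 S2; clear; move=> h; lra.
apply: le_trans (ler_wpM2r y0 a2) _.
by rewrite /y -powRD_gt0 // ler_powR // addrC.
Qed.

(** With r = l ^ (- eps / 16) and dl = r ^ 4, the last term of count_bad_primes is
    at most a constant times X / l ^ (1 + eps / 2), because the number of points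
    is about X l ^ (2 + eps). *)
Lemma exceptional_primes_le (R : realType) (lambda n0 : nat) (eps c1 c2 X : R)
    (nu : nat -> R) (s : nat -> nat) :
  (2 <= lambda)%N -> 0 < eps -> 0 < c1 ->
  (1 + c1) * (15%:R / 14%:R + c1) + c2 <= 13%:R / 12%:R ->
  (forall n, (n0 <= n)%N -> nu n <= c1) ->
  (forall n, (1 <= n)%N -> (0 < s n)%N) ->
  (forall m n, (1 <= m)%N -> (m < n)%N -> (s m < s n)%N) ->
  (forall n, (1 <= n)%N -> (s n)%:R <= n%:R `^ (15%:R / 14%:R + nu n)) ->
  2 <= X -> 2 * n0%:R <= X -> 2 <= ln X -> 2 `^ (16 / eps) <= ln X ->
  ln X `^ (2 + eps) <= X `^ c1 -> 320 * ln X `^ 4%:R <= X `^ c2 ->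
  2 * ln X `^ (1 + 3 * (eps / 16)) <= X `^ (1 / 2) ->
  (count (fun p : nat => ~~ (discrepancy
       (power_residues R lambda s (num_points eps X) p)
         <= 20 * ln X `^ (- (eps / 16)))) (primes_upto X))%:R <=
  lambda%:R + (2 * lambda%:R + 5) * X / ln X ^+ 2 +
  482 * X / (ln X * ln X `^ (eps / 2)).
Proof.
move=> l2 eps0 c10 c12 hn0 s_pos s_incr s_le X1 Xn0 le2 lr a1 a2 a3.
set l := ln X in le2 lr a1 a2 a3 *.
have lw : 0 <= l by apply: le_trans le2.
have l1 : 1 <= l by clear -le2; lra.
have l0 : 0 < l by apply: lt_le_trans l1.
have Xw : 0 <= X by apply: le_trans X1.
have X0 : 0 < X by apply: lt_le_trans X1.
have Xge1 : 1 <= X by clear -X1; lra.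
pose W := X `^ (12%:R^-1).
have W1 : 1 <= W by apply: powR_ge1.
have WE n : W ^+ n = X `^ (n%:R / 12%:R).
  by rewrite -powR_mulrn ?powR_ge0 // -powRrM mulrC.
have W12 : W ^+ 12 = X by rewrite WE divff ?powRr1.
set N := num_points eps X.
have e2 : 0 <= 2 + eps by rewrite addr_ge0 // ltW.
have P0 : 1 <= l `^ (2 + eps) by apply: powR_ge1.
have XP : X <= X * l `^ (2 + eps) by rewrite -[leLHS]mulr1 ler_wpM2l.
have Nge : X * l `^ (2 + eps) / 2 <= N%:R.
  by apply: truncn_ge_half; apply: le_trans XP.
have Nle : N%:R <= X * l `^ (2 + eps) by rewrite truncn_le // (le_trans Xw).
have NX : X / 2 <= N%:R by apply: le_trans Nge; rewrite ler_wpM2r.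
have N1 : 1 <= N%:R :> R by apply: le_trans NX; clear -X1; lra.
have N0 : (0 < N)%N by rewrite -(ler1n R).
have Nn0 : (n0 <= N)%N by rewrite -(ler_nat R); clear -Xn0 NX; lra.
pose ss := [seq s n | n <- iota 1 N].
have szs : size ss = N by rewrite size_map size_iota.
have sle n : (1 <= n <= N)%N -> (s n <= s N)%N.
  move=> /andP[n1]; rewrite leq_eqVlt => /orP[/eqP -> //|nN].
  by rewrite ltnW // s_incr.
have us : uniq ss.
  rewrite map_inj_in_uniq ?iota_uniq // => m n.
  rewrite !mem_iota => /andP[m1 _] /andP[n1 _] E.
  case: (ltngtP m n) => // h.
    by have := s_incr m n m1 h; rewrite E ltnn.
  by have := s_incr n m n1 h; rewrite E ltnn.
have ltS : all (fun k => k < (s N).+1)%N ss.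
  apply/allP => _ /mapP[n + ->]; rewrite mem_iota add1n ltnS => h.
  by rewrite ltnS sle.
have Sbound : 160 * l ^+ 4 * (s N).+1%:R <= W ^+ 13.
  rewrite WE; apply: (@exponent_budget R X l c1 c2 (nu N) N) => //.
  - apply: le_trans Nle _; exact: ler_wpM2l.
  - exact: hn0.
  - exact: s_pos.
  - exact: s_le.
pose r := l `^ (- (eps / 16)).
have r0 : 0 < r by rewrite powR_gt0.
have rn n : r ^+ n = l `^ (- (n%:R * (eps / 16))).
  by rewrite -powR_mulrn ?powR_ge0 // -powRrM mulNr mulrC.
have r2 : r <= 1 / 2.
  rewrite /r powRN div1r lef_pV2 ?posrE ?powR_gt0 //.
  have -> : 2 = (2 `^ (16 / eps)) `^ (eps / 16) :> R.
    rewrite -powRrM (_ : 16 / eps * (eps / 16) = 1) ?powRr1 //.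
    by field; apply: lt0r_neq0.
  by rewrite ge0_ler_powR ?nnegrE ?powR_ge0 ?divr_ge0 // ltW.
have W6 : W ^+ 6 = X `^ (1 / 2) by rewrite WE; congr (_ `^ _); field.
have r3 : 2 * r ^- 3 <= W ^+ 6 / l.
  rewrite W6 ler_pdivlMr // rn -powRN opprK.
  apply: le_trans a3.
  rewrite powRD_gt0 //.
  by rewrite powRr1 // -mulrA [X in 2 * X]mulrC.
have dl0 : 0 < r ^+ 4 by rewrite exprn_gt0.
have main := @count_bad_primes R lambda ss (s N).+1 W (r ^+ 4) l2 us ltS.
rewrite W12 -/l szs in main.
have {main} main := main N0 isT W1 dl0 (_ : 1 <= l) _.
apply: le_trans (_ : (count (fun p => ~~ ((W ^+ 6 / l < p%:R) && `[< well_spread lambda ss (r ^+ 4) p >]))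
     (primes_upto X))%:R <= _).
  rewrite ler_nat -!size_filter; apply: uniq_leq_size.
    by rewrite !filter_uniq ?iota_uniq.
  move=> p; rewrite mem_filter => /andP[bad ps]; rewrite mem_filter ps andbT.
  apply: contra bad => /andP[Wp /asboolP ws].
  apply: well_spread_discrepancy => //.
  - by move: ps; rewrite mem_filter => /andP[].
  - by rewrite r0.
  - exact: le_trans r3 (ltW Wp).
apply: le_trans (main _ _) _ => //.
rewrite lerD2l.
have W24 : W ^+ 24 = X ^+ 2 by rewrite -W12 -exprM.
have r8 : (r ^+ 4) ^+ 2 = (l `^ (eps / 2))^-1.
  by rewrite -exprM rn -powRN; congr (_ `^ _); field.
rewrite W24 r8; set q := l `^ (eps / 2).
have q0 : 0 < q by rewrite powR_gt0.
have lq : l `^ (2 + eps) = l ^+ 2 * q ^+ 2.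
  rewrite powRD_gt0 //.
  rewrite (powR_mulrn 2) //; congr (_ * _).
  by rewrite /q -powR_mulrn ?powR_ge0 // -powRrM; congr (_ `^ _); field.
rewrite lq in Nge.
have NR : 0 < N%:R :> R by apply: lt_le_trans N1.
rewrite ler_pdivrMr; last by rewrite mulr_gt0 ?invr_gt0.
have c0 : 0 <= 482 * X / (l * q).
  apply: divr_ge0; last exact: ltW (mulr_gt0 l0 q0).
  by apply: mulr_ge0 Xw; apply: ler0n.
apply: le_trans (_ : 482 * X / (l * q) * (q^-1 * (X * (l ^+ 2 * q ^+ 2) / 2)) <= _).
  by rewrite le_eqVlt; apply/orP; left; apply/eqP; field; apply/andP; split; apply: lt0r_neq0.
by rewrite (ler_wpM2l c0) // ler_wpM2l // invr_ge0 ltW.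
Qed.

Lemma exceptional_primes_near (R : realType) (lambda : nat) (eps : R) (nu : nat -> R)
  (s : R -> nat -> nat) :
  (2 <= lambda)%N -> 0 < eps -> nu n @[n --> \oo] --> (0 : R) ->
  (forall (X : R) (n : nat), (1 <= n)%N -> (0 < s X n)%N) ->
  (forall (X : R) (m n : nat), (1 <= m)%N -> (m < n)%N -> (s X m < s X n)%N) ->
  (forall (X : R) (n : nat), (1 <= n)%N ->
     (s X n)%:R <= n%:R `^ (15%:R / 14%:R + nu n)) ->
  \forall X \near +oo,
    (count (fun p : nat => ~~ (discrepancy
         (power_residues R lambda (s X) (num_points eps X) p)
           <= 20 * ln X `^ (- (eps / 16)))) (primes_upto X))%:R <=
    lambda%:R + (2 * lambda%:R + 5) * X / ln X ^+ 2 +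
    482 * X / (ln X * ln X `^ (eps / 2)).
Proof.
move=> l2 eps0 hnu s_pos s_incr s_le.
have [c1 [c2 [c10 c20 c12]]] : exists c1 c2 : R,
    [/\ 0 < c1, 0 < c2 & (1 + c1) * (15%:R / 14%:R + c1) + c2 <= 13%:R / 12%:R].
  by exists (1 / 1000), (1 / 1000); split; lra.
have [n0 hn0] : exists n0 : nat, forall n, (n0 <= n)%N -> nu n <= c1.
  move/cvgrPdist_le : hnu => /(_ _ c10)[n0 _ h]; exists n0 => n nn.
  by have := h n nn; rewrite /= sub0r normrN => /ler_normlP[_].
near=> X.
have X2 : 2 <= X by near: X; apply: nbhs_pinfty_ge; exact: num_real.
have Xn : 2 * n0%:R <= X by near: X; apply: nbhs_pinfty_ge; exact: num_real.
have lX : 2 <= ln X by near: X; apply: ln_ge_near.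
have lr : 2 `^ (16 / eps) <= ln X by near: X; apply: ln_ge_near.
have a2 : 320 * ln X `^ 4%:R <= X `^ c2.
  by near: X; apply: ln_powR_le c20; apply: ler0n.
have a3 : 2 * ln X `^ (1 + 3 * (eps / 16)) <= X `^ (1 / 2).
  near: X; apply: ln_powR_le => //.
  by rewrite addr_ge0 // mulr_ge0 // divr_ge0 // ltW.
have a1 : 1 * ln X `^ (2 + eps) <= X `^ c1.
  by near: X; apply: ln_powR_le => //; rewrite addr_ge0 // ltW.
rewrite mul1r in a1.
exact: (@exceptional_primes_le R lambda n0 eps c1 c2 X nu (s X) l2 eps0 c10 c12 hn0
  (s_pos X) (s_incr X) (s_le X) X2 Xn lX lr a1 a2 a3).
Unshelve. all: by end_near. Qed.

(* s X is the sequence (s_n) attached to the parameter X; only its values at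
   n >= 1 matter. *)
Theorem mainTheorem3 (R : realType) (lambda : nat) (eps : R) (nu : nat -> R)
  (s : R -> nat -> nat)
  (hlambda : (2 <= lambda)%N)
  (heps : 0 < eps)
  (hnu : nu n @[n --> \oo] --> (0 : R))
  (s_pos : forall (X : R) (n : nat), (1 <= n)%N -> (0 < s X n)%N)
  (s_incr : forall (X : R) (m n : nat),
     (1 <= m)%N -> (m < n)%N -> (s X m < s X n)%N)
  (s_le : forall (X : R) (n : nat), (1 <= n)%N ->
     (s X n)%:R <= n%:R `^ (15%:R / 14%:R + nu n)) :
  exists eps1 C : R, [/\ 0 < eps1, 0 < C &
    exists delta : R -> R,
      delta X @[X --> +oo] --> (0 : R) /\
      \forall X \near +oo,
        (count (fun p : nat =>
             discrepancy
               (power_residues R lambda (s X) (num_points eps X) p)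
               <= C * ln X `^ (- eps1))
           (primes_upto X))%:R
        = (primepi X)%:R * (1 + delta X)].
Proof.
exists (eps / 16), 20; split => //; first by rewrite divr_gt0.
pose good X p := discrepancy (power_residues R lambda (s X) (num_points eps X) p)
               <= 20 * ln X `^ (- (eps / 16)).
pose bad X : R := (count (fun p => ~~ good X p) (primes_upto X))%:R.
exists (fun X => - (bad X / (primepi X)%:R)).
have goodE X : (count (good X) (primes_upto X))%:R = (primepi X)%:R - bad X :> R.
  rewrite /bad /primepi -(count_predC (good X)) natrD addrK //.
have pos : \forall X \near +oo, (0 : R) < (primepi (X : R))%:R.
  apply: filterS (nbhs_pinfty_ge (num_real (4 : R))) => X X4.
  apply: lt_le_trans (primepi_ge X4).
  have l0 : 0 < ln X by apply: ln_gt0; apply: lt_le_trans X4; rewrite ltr1n.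
  by rewrite divr_gt0 ?mulr_gt0 // (lt_le_trans _ X4).
split; last first.
  apply: filterS pos => X pX; rewrite goodE mulrDr mulr1 mulrN mulrC divfK //.
  exact: lt0r_neq0.
rewrite -oppr0; apply: cvgN; apply/cvgrPdist_le => e e0.
have few := exceptional_primes_near hlambda heps hnu s_pos s_incr s_le.
have [A A0 AE] : exists2 A : R, 0 <= A & 24 * 482 = A.
  by exists (24 * 482); first by apply: mulr_ge0; apply: ler0n.
near=> X.
have X4 : 4 <= X by near: X; apply: nbhs_pinfty_ge; exact: num_real.
have X0 : 0 < X by apply: lt_le_trans X4.
have l1 : 1 <= ln X by near: X; apply: ln_ge_near.
have b1 : 24 * lambda%:R / e * ln X `^ 1 <= X `^ 1.
  by near: X; apply: ln_powR_le => //; rewrite divr_ge0 // ?mulr_ge0 // ltW.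
have b2 : 24 * (2 * lambda%:R + 5) / e <= ln X by near: X; apply: ln_ge_near.
have b3 : (A / e) `^ (2 / eps) <= ln X by near: X; apply: ln_ge_near.
have p0 : (0 : R) < (primepi X)%:R by near: X.
have f : bad X <= lambda%:R + (2 * lambda%:R + 5) * X / ln X ^+ 2 +
     482 * X / (ln X * ln X `^ (eps / 2)) by near: X.
have pX := primepi_ge X4.
rewrite sub0r normrN ger0_norm ?divr_ge0 // ler_pdivrMr //.
apply: le_trans f _; apply: le_trans (_ : e * (X / (8 * ln X)) <= _); last first.
  by rewrite ler_wpM2l // ltW.
set l := ln X in l1 b1 b2 b3 *; have l0 : 0 < l by apply: lt_le_trans l1.
have lw := ltW l0; have Xw := ltW X0; rewrite !powRr1 // in b1.
set q := l `^ (eps / 2).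
have qe : A / e <= q.
  have z0 : 0 <= A / e by rewrite divr_ge0 // ltW.
  have -> : A / e = ((A / e) `^ (2 / eps)) `^ (eps / 2).
    rewrite -powRrM (_ : 2 / eps * (eps / 2) = 1) ?powRr1 //.
    by field; apply: lt0r_neq0.
  by rewrite ge0_ler_powR ?nnegrE ?powR_ge0 ?divr_ge0 // ltW.
have q0 : 0 < q by rewrite powR_gt0.
have third : e * (X / (8 * l)) = e * X / (24 * l) + e * X / (24 * l) + e * X / (24 * l).
  by field; apply: lt0r_neq0.
(* The three terms of exceptional_primes_near are compared with one third of
   e X / (8 l) each. *)
rewrite third; have l24 : 0 < 24 * l by rewrite mulr_gt0.
apply: lerD; first apply: lerD.
- rewrite ler_pdivlMr //; move: b1; rewrite mulrAC ler_pdivrMr //.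
  by rewrite mulrCA mulrA [e * X]mulrC.
- rewrite ler_pdivlMr //.
  have -> : (2 * lambda%:R + 5) * X / l ^+ 2 * (24 * l) = (24 * (2 * lambda%:R + 5)) * (X / l).
    by field; apply: lt0r_neq0.
  rewrite ler_pdivrMr // in b2.
  have -> : e * X = (l * e) * (X / l) by field; apply: lt0r_neq0.
  by rewrite ler_wpM2r // divr_ge0 // ltW.
- rewrite ler_pdivlMr //.
  have -> : 482 * X / (l * q) * (24 * l) = A * (X / q).
    by rewrite -AE; field; apply/andP; split; apply: lt0r_neq0.
  rewrite ler_pdivrMr // in qe.
  have -> : e * X = (q * e) * (X / q) by field; apply: lt0r_neq0.
  by rewrite ler_wpM2r // divr_ge0 // ltW.
Unshelve. all: by end_near. Qed.
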